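(* Let $K$ be a separably closed field, complete with respect to a non-archimedean absolute value $|\cdot|$, let $f,g\in K[z]$ be monic polynomials of degrees $d=\deg(f)>e=\deg(g)\ge 1$, and suppose that $ed$ is a unit in the ring of integers of $K$. Let $\mathscr{P}$ and $\mathscr{B}$ be the path spaces of the correspondences $g(y)=f(x)$ and $y^e=x^d$, with projections $\pi:\mathscr{P}\to\mathbb{P}^1$ and $\psi:\mathscr{B}\to\mathbb{P}^1$ to the first vertex, and let $\Xi$ be the formal isomorphism from $\mathscr{P}$ to $\mathscr{B}$ at infinity described in the context. Then there exist neighbourhoods $\infty\in U_1\subseteq\mathscr{P}(K)$ and $\infty\in U_2\subseteq\mathscr{B}(K)$ such that $\Xi$ induces an isomorphism $\Xi:U_1\to U_2$. Furthermore, if the correspondence $g(y)=f(x)$ has good reduction, then one may take $U_1=\pi^{-1}(D(\infty;1))$ and $U_2=\psi^{-1}(D(\infty;1))$.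
   Context: Good reduction means that all coefficients of $f$ and $g$ lie in the ring of integers $\{x\in K:|x|\le 1\}$ (the leading coefficients being $1$). For $\epsilon>0$, $D(\infty;\epsilon)=\{\infty\}\cup\{x\in K: |x^{-1}|<\epsilon\}\subseteq\mathbb{P}^1(K)$. Path spaces. $\mathscr{P}(K)$ is the set of sequences $P=(x_0,x_1,\dots)$ with $x_i=[x_{i,0}:x_{i,1}]\in\mathbb{P}^1(K)$ ($x_i=x_{i,1}/x_{i,0}$) satisfying $x_{i+1,0}^{e}x_{i,0}^{d}(g(x_{i+1,1}/x_{i+1,0})-f(x_{i,1}/x_{i,0}))=0$ for all $i\ge0$, topologized as a subspace of $\prod_i\mathbb{P}^1(K)$. $\pi(P)=x_0$, and the shift is $\sigma(x_0,x_1,\dots)=(x_1,x_2,\dots)$. The unique point above $\infty\in\mathbb{P}^1$ is $(\infty,\infty,\dots)$, also written $\infty$; near it one uses the coordinates $w_i=1/x_i$. In the special case $g(y)=y^e$, $f(x)=x^d$ the path space, projection, shift and coordinates are denoted $\mathscr{B}$, $\psi$, $\tau$, $z_i$, so that $z_{i+1}^e=z_i^d$. Formal series. Let $S_n=K[[w_0,\dots,w_n]]/(w_{i+1}^{e}w_i^{d}(g(w_{i+1}^{-1})-f(w_i^{-1})):0\le i<n)$, give $w_i$ weight $(d/e)^i$, and let $S=\mathcal{O}_{\mathscr{P},\infty}$ be the completion of $\varinjlim S_n$ with respect to the filtration by the ideals of classes of power series all of whose monomials have weight $>X$, $X\to\infty$. Likewise define $\mathcal{O}_{\mathscr{B},\infty}$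 from $y^e=x^d$ with the variables $z_i$. For each $n$ there is an element $\xi_n\in S_n$, of the form $w_0$ plus terms of weight $>1$, with $\xi_n^{d^n}=w_n^{e^n}$; the sequence $\xi_n$ converges in $S$ to an element $\xi$, which satisfies $(\xi\circ\sigma)^e=\xi^d$ (where $\circ\sigma$ is induced by $w_i\mapsto w_{i+1}$). The formal morphism $\Xi=(\xi,\xi\circ\sigma,\xi\circ\sigma^2,\dots)$, meaning $z_i=\xi\circ\sigma^i$, is an isomorphism $\operatorname{Spec}(\mathcal{O}_{\mathscr{P},\infty})\to\operatorname{Spec}(\mathcal{O}_{\mathscr{B},\infty})$ of $K$-schemes with $\Xi\circ\sigma=\tau\circ\Xi$; its inverse is of the form $\Psi=(\gamma,\gamma\circ\tau,\gamma\circ\tau^2,\dots)$ (meaning $w_i=\gamma\circ\tau^i$) for some $\gamma\in\mathcal{O}_{\mathscr{B},\infty}$. Evaluation. Write $\xi=\sum_w c(w)w$, the sum over monomials $w$ in the $w_i$, with $c(w)\in K$; the expansion is made unique by using only monomials in which each $w_i$ with $i\ge1$ has exponent less than $e$. For $P\in\mathscr{P}(K)$ with all $x_i\neq0$, set $\xi(P)=\lim_{X\to\infty}\sum_{\mathrm{weight}(w)\le X}c(w)w(P)$, if the limit exists. Then $\Xi(P)$ is the point of $\mathscr{B}(K)$ with coordinates $z_i=\xi(\sigma^i(P))$. The same conventions define evaluation of $\gamma$ and $\Psi$ on $\mathscr{B}(K)$. ''$\Xi$ induces an isomorphism $U_1\to U_2$'' means that the series defining $\Xi$ converges on $U_1$,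 that the series defining $\Psi$ converges on $U_2$, and that they give mutually inverse bijections between $U_1$ and $U_2$. *)

(* Defs.v *)
From HB Require Import structures.
From mathcomp Require Import all_boot all_order all_algebra all_field.
From mathcomp Require Import all_classical all_reals all_analysis.

Set Implicit Arguments.
Unset Strict Implicit.
Unset Printing Implicit Defensive.

Import Order.TTheory GRing.Theory Num.Theory.

Local Open Scope classical_set_scope.
Local Open Scope ring_scope.

(** * Non-archimedean fields *)

(* The trivial absolute value is allowed. *)
Record nonarch_absval (R : realType) (K : fieldType) := NonarchAbsval {
  absval :> K -> R;
  absval_ge0 : forall x, 0 <= absval x;
  absval_eq0 : forall x, absval x = 0 <-> x = 0;
  absvalM : forall x y, absval (x * y) = absval x * absval y;
  absval_ultra : forall x y, absval (x + y) <= Num.max (absval x) (absval y)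
}.

Definition separably_closed (K : fieldType) : Prop :=
  forall p : {poly K}, separable_poly p -> (1 < size p)%N -> exists x, root p x.

Section ValuedField.
Variables (R : realType) (K : fieldType) (v : nonarch_absval R K).

Definition complete_absval : Prop :=
  forall u : nat -> K,
    (forall eps : R, 0 < eps -> exists N : nat, forall m n : nat,
       (N <= m)%N -> (N <= n)%N -> v (u m - u n) < eps) ->
    exists l : K, forall eps : R, 0 < eps -> exists N : nat, forall n : nat,
       (N <= n)%N -> v (u n - l) < eps.

Definition integral_elt (x : K) : Prop := v x <= 1.

Definition integral_unit (x : K) : Prop :=
  integral_elt x /\ exists2 y, integral_elt y & x * y = 1.

Definition good_reduction (f g : {poly K}) : Prop :=
  forall i, integral_elt f`_i /\ integral_elt g`_i.

End ValuedField.

(** * The projective line and its topology *)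

(* [None] is the point at infinity [0 : 1], and [Some x] is [1 : x].  The
   absolute value is a parameter because it determines the topology. *)
Definition P1 (R : realType) (K : fieldType) (v : nonarch_absval R K) : Type :=
  option K.

HB.instance Definition _ (R : realType) (K : fieldType)
  (v : nonarch_absval R K) := Choice.on (P1 v).

Section ProjectiveLine.
Variables (R : realType) (K : fieldType) (v : nonarch_absval R K).

(* The condition [x != 0] is needed since [0^-1 = 0]. *)
Definition disc_infty (eps : R) : set (P1 v) :=
  [set p | match p with
           | None => True
           | Some x => x != 0 /\ v x^-1 < eps
           end].

Definition P1_open : set_system (P1 v) :=
  [set U | (forall a : K, U (Some a) -> exists2 eps : R, 0 < eps &
              forall b : K, v (b - a) < eps -> U (Some b)) /\
           (U None -> exists2 eps : R, 0 < eps & disc_infty eps `<=` U)].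

Lemma P1_openT : P1_open setT.
Proof. by split=> [a _|_]; exists 1. Qed.

Lemma P1_openI : setI_closed P1_open.
Proof.
move=> A B [Af Ai] [Bf Bi]; split=> [a [/Af[r r0 rA] /Bf[s s0 sB]]|].
  exists (Num.min r s) => [|b]; first by rewrite lt_min r0.
  by rewrite lt_min => /andP[/rA ? /sB ?].
move=> [/Ai[r r0 rA] /Bi[s s0 sB]].
exists (Num.min r s) => [|[x [x0]|_]]; first by rewrite lt_min r0.
  by rewrite lt_min => /andP[xr xs]; split; [exact: rA|exact: sB].
by split; [exact: rA|exact: sB].
Qed.

Lemma P1_open_bigU (I : Type) (U : I -> set (P1 v)) :
  (forall i, P1_open (U i)) -> P1_open (\bigcup_i U i).
Proof.
move=> Uo; split=> [a|] [i _] Ui.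
  by have [r r0 rU] := (Uo i).1 a Ui; exists r => // b /rU; exists i.
by have [r r0 rU] := (Uo i).2 Ui; exists r => // p /rU; exists i.
Qed.

HB.instance Definition _ :=
  isOpenTopological.Build (P1 v) P1_openT P1_openI P1_open_bigU.

Definition hcoord (p : P1 v) : K * K :=
  match p with None => (0, 1) | Some x => (1, x) end.

(* The coordinate [w = 1/x]; it is only meaningful on [P1] minus the point 0. *)
Definition wcoord (p : P1 v) : K :=
  match p with None => 0 | Some x => x^-1 end.

Definition of_wcoord (w : K) : P1 v := if w == 0 then None else Some w^-1.

End ProjectiveLine.

(** * Path spaces *)

Notation degp p := (size p).-1.

(* With [n] the degree of [p], this is [x_0 ^ n * p (x_1 / x_0)]. *)
Definition homog (A : comNzRingType) (n : nat) (p : {poly A}) (x : A * A) : A :=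
  \sum_(j < n.+1) p`_j * x.2 ^+ j * x.1 ^+ (n - j).

(* [y_0 ^ e * x_0 ^ d * (g (y_1 / y_0) - f (x_1 / x_0))] *)
Definition correspondence (A : comNzRingType) (d e : nat) (f g : {poly A})
    (x y : A * A) : A :=
  x.1 ^+ d * homog e g y - y.1 ^+ e * homog d f x.

Section PathSpace.
Variables (R : realType) (K : fieldType) (v : nonarch_absval R K).

Definition sequence_P1 := {ptws nat -> P1 v}.

Definition pathspace (f g : {poly K}) : set sequence_P1 :=
  [set P | forall i : nat,
     correspondence (degp f) (degp g) f g (hcoord (P i)) (hcoord (P i.+1)) = 0].

Definition path_infty : sequence_P1 := fun=> None.

Definition path_shift (n : nat) (P : sequence_P1) : sequence_P1 :=
  fun i => P (n + i)%N.

Definition path_proj (P : sequence_P1) : P1 v := P 0%N.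

Definition nbhs_infty_in (f g : {poly K}) (U : set sequence_P1) : Prop :=
  U `<=` pathspace f g /\ within (pathspace f g) (nbhs path_infty) U.

Definition over_disc (f g : {poly K}) (eps : R) : set sequence_P1 :=
  pathspace f g `&` path_proj @^-1` @disc_infty R K v eps.

End PathSpace.
Arguments over_disc {R K} v f g eps.

(** * Formal power series in the variables w_0, w_1, w_2, ... *)

(* The monomial [\prod_i w_i ^ a_i] is represented by the finitely supported
   sequence of its exponents, stored as [\sum_i a_i *: 'X^i : {poly nat}]; only
   the additive structure of [{poly nat}] is used, and it corresponds to
   multiplication of monomials.  In particular the monomial 1 is [0] and the
   monomial [w_i] is ['X^i]. *)
Notation monomial := {poly nat}.

Definition monomial_eval (A : comNzRingType) (u : nat -> A) (m : monomial) : A :=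
  \prod_(i < size m) u i ^+ (m`_i)%R.

Definition weight (d e : nat) (m : monomial) : rat :=
  \sum_(i < size m) (m`_i)%R%:R * (d%:R / e%:R) ^+ i.

Section Monomials.
Implicit Types k m : monomial.

Definition mon_le (k m : monomial) : bool := [forall i : 'I_(size m + size k), ((k`_i)%R <= (m`_i)%R)%N].

Lemma mon_leP k m : reflect (forall i, ((k`_i)%R <= (m`_i)%R)%N) (mon_le k m).
Proof.
apply: (iffP forallP) => [h i|h i]; last exact: h.
have [li|] := ltnP i (size m + size k); first exact: h (Ordinal li).
move=> /(leq_trans (leq_addl _ _)) ki.
by rewrite nth_default.
Qed.

Definition mon_sub (m k : monomial) : monomial := \poly_(i < size m) ((m`_i)%R - (k`_i)%R)%N.

Lemma mon_subE m k i : (mon_sub m k)`_i = ((m`_i)%R - (k`_i)%R)%N.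
Proof.
by rewrite coef_poly; case: ltnP => // mi; rewrite nth_default.
Qed.

Lemma mon_subK m k : mon_le k m -> k + mon_sub m k = m.
Proof. by move=> /mon_leP km; apply/polyP => i; rewrite coefD mon_subE; exact: subnKC. Qed.

Lemma mon_addK m k : mon_sub (k + m) k = m.
Proof. by apply/polyP => i; rewrite mon_subE coefD; exact: addKn. Qed.

Lemma mon_le_addr m k : mon_le k (k + m).
Proof. by apply/mon_leP => i; rewrite coefD; exact: leq_addr. Qed.

Definition mon_divisors (m : monomial) : seq monomial :=
  undup [seq k <- [seq \poly_(i < size m) (t (inord i) : nat)
                   | t : {ffun 'I_(size m).+1 -> 'I_(\max_(i < size m) (m`_i)%R).+1}]
        | mon_le k m].

Lemma mem_mon_divisors k m : (k \in mon_divisors m) = mon_le k m.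
Proof.
rewrite mem_undup mem_filter andb_idr// => km; have /mon_leP kmi := km.
apply/mapP; exists [ffun i : 'I_(size m).+1 => inord (k`_i)%R].
  by rewrite mem_enum.
apply/polyP => i; rewrite coef_poly; case: ltnP => [im|mi].
  rewrite ffunE !inordK ?ltnS ?(ltnW im)//.
  by rewrite (leq_trans (kmi i))// (@leq_bigmax 'I_(size m) (fun j : 'I_(size m) => (m`_j)%R) (Ordinal im)).
by apply/eqP; rewrite -leqn0 (leq_trans (kmi i))// nth_default.
Qed.

Lemma mon_divisors_uniq m : uniq (mon_divisors m). Proof. exact: undup_uniq. Qed.

End Monomials.

(* [F m] is the coefficient of [m].  The alias keeps the convolution product
   apart from the pointwise product of functions. *)
Definition fseries (K : fieldType) : Type := monomial -> K.

HB.instance Definition _ (K : fieldType) :=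
  GRing.Zmodule.copy (fseries K) (monomial -> K).

Section FseriesRing.
Variable K : fieldType.
Implicit Types (F G H : fseries K) (k m : monomial).

Definition fseries_mul F G : fseries K :=
  fun m => \sum_(k \in [set k : monomial * monomial | k.1 + k.2 = m])
             F k.1 * G k.2.

Definition mconst (a : K) : fseries K := fun m => if m == 0 then a else 0.

Definition mvar (i : nat) : fseries K := fun m => (m == 'X^i)%:R.

Lemma fseries_mulE F G m : fseries_mul F G m = \sum_(k <- mon_divisors m) F k * G (mon_sub m k).
Proof.
have -> : \sum_(k <- mon_divisors m) F k * G (mon_sub m k) =
    \sum_(p <- [seq (k, mon_sub m k) | k <- mon_divisors m]) F p.1 * G p.2.
  by rewrite big_map.
rewrite fsbig_seq; last first.
  by rewrite map_inj_uniq ?mon_divisors_uniq// => x y [].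
apply: eq_fsbigl; apply/seteqP; split=> -[a b] /=.
  move=> <-; apply/mapP; exists a; first by rewrite mem_mon_divisors mon_le_addr.
  by rewrite mon_addK.
by move=> /mapP[k + [-> ->]]; rewrite mem_mon_divisors; exact: mon_subK.
Qed.

Lemma fseries_mulC : commutative fseries_mul.
Proof.
move=> F G; apply/funext => m; rewrite !fseries_mulE.
have inj : {in mon_divisors m &, injective (mon_sub m)}.
  move=> x y; rewrite !mem_mon_divisors => /mon_subK xm /mon_subK ym e.
  have : x + mon_sub m x = y + mon_sub m x by rewrite xm e ym.
  by move=> /polyP h; apply/polyP => i; have := h i; rewrite !coefD => /addIn.
have bm k : mon_le k m -> mon_le (mon_sub m k) m.
  by move=> /mon_subK {2}<-; rewrite [k + _]addrC mon_le_addr.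
have sK k : mon_le k m -> mon_sub m (mon_sub m k) = k.
  by move=> /mon_subK {1}<-; rewrite [k + _]addrC mon_addK.
rewrite [RHS](perm_big [seq mon_sub m k | k <- mon_divisors m])/=; last first.
  apply: uniq_perm; rewrite ?mon_divisors_uniq//; first by rewrite map_inj_in_uniq ?mon_divisors_uniq.
  move=> k; rewrite mem_mon_divisors; apply/idP/mapP => [km|[j]].
    by exists (mon_sub m k); rewrite ?mem_mon_divisors ?bm ?sK.
  by rewrite mem_mon_divisors => jm ->; exact: bm.
rewrite big_map; apply: eq_big_seq => k; rewrite mem_mon_divisors => km.
by rewrite sK// mulrC.
Qed.

Lemma fseries_mul1 : left_id (mconst 1) fseries_mul.
Proof.
move=> F; apply/funext => m; rewrite fseries_mulE (bigD1_seq 0) ?mon_divisors_uniq//=; last first.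
  by rewrite mem_mon_divisors; apply/mon_leP => i; rewrite coef0.
rewrite /mconst eqxx mul1r big1 ?addr0.
  by congr F; rewrite -[RHS](mon_addK m 0) add0r.
by move=> k /negPf ->; rewrite mul0r.
Qed.

Lemma fseries_mulD : left_distributive fseries_mul +%R.
Proof.
move=> F G H; apply/funext => m; rewrite [RHS]/GRing.add/= !fseries_mulE -big_split.
by apply: eq_bigr => k _; exact: mulrDl.
Qed.

Lemma fseries_mulA : associative fseries_mul.
Proof.
move=> F G H; apply/funext => m; rewrite !fseries_mulE.
under eq_bigr do rewrite fseries_mulE big_distrr/=.
under [RHS]eq_bigr do rewrite fseries_mulE big_distrl/=.
have tr a b c : mon_le a b -> mon_le b c -> mon_le a c.
  by move=> /mon_leP ab /mon_leP bc; apply/mon_leP => i; exact: leq_trans (ab i) (bc i).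
have -> : \sum_(a <- mon_divisors m) \sum_(p <- mon_divisors a) F p * G (mon_sub a p) * H (mon_sub m a)
  = \sum_(a <- mon_divisors m) \sum_(p <- mon_divisors m | mon_le p a) F p * G (mon_sub a p) * H (mon_sub m a).
  apply: eq_big_seq => a; rewrite mem_mon_divisors => am.
  rewrite -[RHS]big_filter; apply: perm_big; apply: uniq_perm; rewrite ?filter_uniq ?mon_divisors_uniq//.
  move=> k; rewrite mem_filter !mem_mon_divisors andb_idr//.
  by move=> ka; exact: tr ka am.
rewrite (exchange_big_dep predT)//=.
apply: eq_big_seq => p; rewrite mem_mon_divisors => pm.
rewrite -[RHS]big_filter [RHS](perm_big [seq p + q | q <- mon_divisors (mon_sub m p)])/=; last first.
  apply: uniq_perm; first by rewrite filter_uniq ?mon_divisors_uniq.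
    rewrite map_inj_uniq ?mon_divisors_uniq// => x y e.
    by rewrite -[x](mon_addK _ p) e mon_addK.
  move=> a; rewrite mem_filter mem_mon_divisors; apply/andP/mapP.
    move=> [pa am]; exists (mon_sub a p); last by rewrite mon_subK.
    rewrite mem_mon_divisors; apply/mon_leP => i; rewrite !mon_subE leq_sub2r//.
    by move/mon_leP: am.
  move=> [q]; rewrite mem_mon_divisors => /mon_leP qm ->; split; first exact: mon_le_addr.
  apply/mon_leP => i; rewrite -[m in leqRHS](mon_subK pm) !coefD.
  exact: leq_add (leqnn _) (qm i).
rewrite big_map; apply: eq_bigr => q _; rewrite mon_addK mulrA; congr (_ * H _).
by apply/polyP => i; rewrite !mon_subE coefD; exact: esym (subnDA _ _ _).
Qed.

Lemma fseries_one_neq0 : mconst 1 != 0 :> fseries K.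
Proof.
apply/eqP => /(congr1 (fun F : fseries K => F 0)).
by rewrite /mconst eqxx => /eqP; rewrite oner_eq0.
Qed.

HB.instance Definition _ := GRing.Zmodule_isComNzRing.Build (fseries K)
  fseries_mulA fseries_mulC fseries_mul1 fseries_mulD fseries_one_neq0.

End FseriesRing.

(** * The formal neighbourhood of infinity in a path space *)

Section FormalNeighbourhood.
Variables (K : fieldType) (f g : {poly K}).
Local Notation d := (degp f).
Local Notation e := (degp g).

(* [w_{i+1} ^ e * w_i ^ d * (g (w_{i+1} ^ -1) - f (w_i ^ -1))] *)
Definition path_rel (i : nat) : fseries K :=
  correspondence d e (map_poly (@mconst K) f) (map_poly (@mconst K) g)
    (mvar K i, 1) (mvar K i.+1, 1).

(* Membership in [K[[w_0, ..., w_n]]]. *)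
Definition in_vars (n : nat) : set (fseries K) :=
  [set F | forall m : monomial, F m != 0 -> (size m <= n.+1)%N].

Definition path_ideal (n : nat) : set (fseries K) :=
  [set F | exists2 h : nat -> fseries K, (forall i, in_vars n (h i)) &
           F = \sum_(i < n) h i * path_rel i].

(* Equality in S_n = K[[w_0, ..., w_n]] / (path_rel i, i < n). *)
Definition eq_Sn (n : nat) (F G : fseries K) : Prop :=
  [/\ in_vars n F, in_vars n G & path_ideal n (F - G)].

(* The ideal of [colim_n S_n] consisting of the classes of power series all of
   whose monomials have weight > X. *)
Definition filtration (X : rat) : set (fseries K) :=
  [set F | exists n G, eq_Sn n F G /\ forall m : monomial, G m != 0 -> X < weight d e m].

(* The elements of the completion S of [colim_n S_n] are represented by Cauchy
   sequences in [colim_n S_n]; this is equality of their limits. *)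
Definition eq_Slim (u w : nat -> fseries K) : Prop :=
  forall X : rat, exists N : nat, forall n : nat,
    (N <= n)%N -> filtration X (u n - w n).

(* The partial sums of [\sum_m F m * m] by weight.  There are only finitely many
   monomials of bounded weight when [0 < e < d], so these are polynomials, and
   they form a Cauchy sequence, which defines the class of [F] in S. *)
Definition partial_sums (F : fseries K) : nat -> fseries K :=
  fun n (m : monomial) => if weight d e m <= n%:R then F m else 0.

Definition normal_series (F : fseries K) : Prop :=
  forall m : monomial, F m != 0 -> forall i, (0 < i)%N -> ((m`_i)%R < e)%N.

(* [xi] is the family of coefficients of the normal expansion of the limit in S
   of elements [xi_ n] of the [S_n]; those are unique when [d * e] is invertible
   in [K]. *)
Definition is_xi (xi : fseries K) : Prop :=
  normal_series xi /\
  exists xi_ : nat -> fseries K,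
    (forall n, [/\ in_vars n (xi_ n),
                   forall m : monomial, (xi_ n - mvar K 0) m != 0 -> 1 < weight d e m &
                   eq_Sn n (xi_ n ^+ (d ^ n)) (mvar K n ^+ (e ^ n))]) /\
    eq_Slim xi_ (partial_sums xi).

End FormalNeighbourhood.

Section FormalMorphisms.
Variable K : fieldType.
Implicit Types (F G : fseries K).

(* The substitution [w_i |-> w_{i+1}]. *)
Definition fseries_shift F : fseries K :=
  fun m : monomial => if (m`_0 == 0)%R then F (drop_poly 1 m) else 0.

(* The sequence [(F, F o sigma, F o sigma^2, ...)]. *)
Definition orbit_series F : nat -> fseries K := fun i => iter i fseries_shift F.

(* The substitution [w_i |-> u i].  The sum is finite whenever every coefficient
   of [\prod_i u i ^ k_i] vanishes for all but finitely many [k] in the support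
   of [F], in particular if [F] is a polynomial or if the monomials in [u i] have
   weight at least [(d / e) ^ i], where [0 < e < d]. *)
Definition fseries_subst F (u : nat -> fseries K) : fseries K :=
  fun m : monomial => \sum_(k \in [set: monomial]) F k * monomial_eval u k m.

(* The substitution [w'_i |-> F o sigma^i] takes the relations between the
   variables of (f', g') to 0 in the completed local ring of (f, g). *)
Definition formal_morphism (f g f' g' : {poly K}) F : Prop :=
  forall i, eq_Slim f g
    (partial_sums f g (fseries_subst (path_rel f' g' i) (orbit_series F)))
    (fun=> 0).

(* Substituting the orbit of [F] into [G o sigma^i] gives [w_i] for all [i]. *)
Definition orbits_cancel (f g : {poly K}) F G : Prop :=
  forall i, eq_Slim f g
    (partial_sums f g (fseries_subst (orbit_series G i) (orbit_series F)))
    (fun=> mvar K i).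

(* [xi] and [gamma] define mutually inverse formal morphisms between the path
   spaces of (f, g) and (f', g') at infinity. *)
Definition formal_inverse (f g f' g' : {poly K}) (xi gamma : fseries K) : Prop :=
  [/\ normal_series g' gamma,
      formal_morphism f g f' g' xi,
      formal_morphism f' g' f g gamma,
      orbits_cancel f g xi gamma &
      orbits_cancel f' g' gamma xi].

End FormalMorphisms.

(** * Evaluation of formal series on path spaces *)

Section Evaluation.
Variables (R : realType) (K : fieldType) (v : nonarch_absval R K).
Variables (d e : nat).
Implicit Types (F G : fseries K) (P : sequence_P1 v).

Definition eval_partial F P (X : rat) : K :=
  \sum_(m \in [set m : monomial | weight d e m <= X])
     F m * monomial_eval (fun i => wcoord (P i)) m.

Definition eval_cvg_to F P (y : K) : Prop :=
  (forall i, P i <> Some 0) /\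
  forall eps : R, 0 < eps -> exists X0 : rat, forall X : rat,
    X0 <= X -> v (eval_partial F P X - y) < eps.

(* The value [F(P)]; it is 0 by convention if the series does not converge. *)
Definition eval_series F P : K := xget 0 [set y | eval_cvg_to F P y].

Definition orbit_cvg F P : Prop :=
  forall i, exists y, eval_cvg_to F (path_shift i P) y.

Definition orbit_eval F P : sequence_P1 v :=
  fun i => of_wcoord v (eval_series F (path_shift i P)).

Definition induces_iso F G (U1 U2 : set (sequence_P1 v)) : Prop :=
  [/\ forall P, U1 P -> orbit_cvg F P,
      forall Q, U2 Q -> orbit_cvg G Q,
      set_fun U1 U2 (orbit_eval F) /\ set_fun U2 U1 (orbit_eval G),
      forall P, U1 P -> orbit_eval G (orbit_eval F P) = P &
      forall Q, U2 Q -> orbit_eval F (orbit_eval G Q) = Q].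

End Evaluation.

(* Main.v *)
(* Choose C >= 1 such that the coefficient of x^(d-j) in f and of y^(e-j) in g
   has absolute value at most C^j (C = 1 under good reduction), and let U1, U2
   be the preimages of D(oo; 1/C).  On U1, |w_i| = |w_0|^((d/e)^i), so a series
   whose coefficient at m is bounded by C^(weight m - 1) converges there.

   In the local ring at infinity every monomial has a normal form, obtained by
   rewriting w_{i+1}^e as w_i^d g~(w_{i+1}) - w_{i+1}^e (f~(w_i) - 1), where
   f~(w) = w^d f(1/w) and g~(w) = w^e g(1/w).  Weights do not decrease and total
   degrees increase, so this converges; the normal form is compatible with the
   ideal of relations, with the bounds in C, and with evaluation at paths.
   Hence a formal identity between series with such bounds holds at all points
   of U1, although the coefficients in S_n that witness it are uncontrolled.

   The bounds for xi and gamma come from the relation that each of them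
   satisfies: it determines d * c(m) by the coefficients of smaller weight, and
   |d| = 1.  Evaluating the formal identities then shows that Xi and Psi are
   mutually inverse. *)
Require Import Defs.
From mathcomp Require Import all_boot all_order all_algebra all_field.
From mathcomp Require Import all_classical all_reals all_analysis.
From mathcomp Require Import finmap ring lra.

Set Implicit Arguments.
Unset Strict Implicit.
Unset Printing Implicit Defensive.

Import Order.TTheory GRing.Theory Num.Theory.

Local Open Scope classical_set_scope.
Local Open Scope ring_scope.

(** * Absolute values *)

(** Equality in S holds only modulo series [\sum_i h i * path_rel i] whose cofactors [h i] need not
    converge anywhere near infinity, so a formal identity cannot be evaluated as it stands. Each
    coefficient of the normal form is therefore used as a linear functional on series: it reads
    finitely many coefficients and kills every multiple of a relation, convergent or not. A formal
    identity thus becomes a family of exact equations in K. Evaluation re-enters only when a single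
    monomial is compared with its own normal form, where all sizes are known. The weight alone does
    not measure the progress of rewriting, since w_i^d weighs as much as w_{i+1}^e; the total degree
    does, because d > e. The coefficient d appears in the recursion for c(m) because a perturbation
    of weight lam > 1 in the series has weight lam d/e in its shift. In the linearized relation the
    derivative of x^d therefore dominates that of y^e. *)

Section AbsoluteValue.
Variables (R : realType) (K : fieldType) (v : nonarch_absval R K).

Lemma absval0 : v 0 = 0.
Proof. exact/absval_eq0. Qed.

Lemma absval1 : v 1 = 1.
Proof.
have v1 : v 1 != 0 by apply/eqP => /absval_eq0/eqP; rewrite oner_eq0.
by apply: (mulfI v1); rewrite -absvalM !mulr1.
Qed.

Lemma absvalN x : v (- x) = v x.
Proof.
have h : v (-1) ^+ 2 = 1 by rewrite expr2 -absvalM mulrNN mulr1 absval1.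
have v1 : v (-1) = 1.
  by apply/eqP; rewrite -(@pexpr_eq1 _ _ 2) ?absval_ge0// h.
by rewrite -mulN1r absvalM v1 mul1r.
Qed.

Lemma absvalX x n : v (x ^+ n) = v x ^+ n.
Proof. by elim: n => [|n IH]; rewrite ?expr0 ?absval1// !exprS absvalM IH. Qed.

Lemma absval_gt0 x : x != 0 -> 0 < v x.
Proof.
by rewrite lt_neqAle absval_ge0 andbT => x0; apply/eqP => /esym/absval_eq0/eqP; apply/negP.
Qed.

Lemma absvalV x : v x^-1 = (v x)^-1.
Proof.
have [->|x0] := eqVneq x 0; first by rewrite !(invr0, absval0).
have vx0 : v x != 0 by rewrite gt_eqF// absval_gt0.
by apply: (mulfI vx0); rewrite -absvalM !divff// absval1.
Qed.

Lemma absvalD_le b x y : v x <= b -> v y <= b -> v (x + y) <= b.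
Proof. by move=> xb yb; rewrite (le_trans (absval_ultra _ _ _))// ge_max xb. Qed.

Lemma absvalB_le b x y : v x <= b -> v y <= b -> v (x - y) <= b.
Proof. by move=> xb yb; rewrite absvalD_le// absvalN. Qed.

Lemma absvalB_lt b x y : v x < b -> v y < b -> v (x - y) < b.
Proof.
by move=> xb yb; rewrite (le_lt_trans (absval_ultra _ _ _))// gt_max xb absvalN.
Qed.

Lemma absval_sum_le (I : eqType) (s : seq I) (P : pred I) (F : I -> K) b : 0 <= b ->
  (forall i, i \in s -> P i -> v (F i) <= b) -> v (\sum_(i <- s | P i) F i) <= b.
Proof.
move=> b0 Fb; rewrite big_seq_cond; apply: (big_ind (fun x => v x <= b)) => [|x y|i /andP[]].
- by rewrite absval0.
- exact: absvalD_le.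
- exact: Fb.
Qed.

Lemma absval_nat_le1 n : v n%:R <= 1.
Proof.
elim: n => [|n IH]; first by rewrite absval0.
by rewrite -natr1 absvalD_le// absval1.
Qed.

(** The numbers [m], [n] and the inverse of their product all have absolute value at most 1, and
    they multiply to 1. This gives |d| = 1, so that dividing by d costs nothing in the coefficient
    bounds. *)
Lemma absval_unit_factorr m n : integral_unit v (m * n)%:R -> v n%:R = 1.
Proof.
move=> [_ [y y1 /(congr1 v)]]; rewrite natrM !absvalM absval1 => mny.
apply/eqP; rewrite eq_le absval_nat_le1/= -mny mulrAC -[leRHS]mul1r.
by rewrite ler_wpM2r ?absval_ge0// mulr_ile1 ?absval_ge0 ?absval_nat_le1.
Qed.

Definition limit_at_infty (u : rat -> K) (y : K) :=
  forall eps : R, 0 < eps -> exists X0, forall X, X0 <= X -> v (u X - y) < eps.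

Lemma limit_at_infty_uniq u y z :
  limit_at_infty u y -> limit_at_infty u z -> y = z.
Proof.
move=> uy uz; apply/eqP; rewrite -subr_eq0; apply/negP => /negP yz.
have [X0 hX] := uy _ (absval_gt0 yz); have [X1 hX'] := uz _ (absval_gt0 yz).
have h0 : X0 <= Num.max X0 X1 by rewrite le_max lexx.
have h1 : X1 <= Num.max X0 X1 by rewrite le_max lexx orbT.
set X := Num.max X0 X1 in h0 h1.
have := absvalB_lt (hX' _ h1) (hX _ h0).
by rewrite (_ : u X - z - (u X - y) = y - z) ?ltxx//; ring.
Qed.

End AbsoluteValue.

(** * Rational powers *)

Section RationalPower.
Variable R : realType.
Implicit Types (a b : R) (X Y : rat).

(** The exponents are weights, that is, sums of powers of d/e, and so are rational numbers. *)
Definition ratpow a X : R := powR a (ratr X).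

Lemma ratpow_gt0 a X : 0 < a -> 0 < ratpow a X.
Proof. exact: powR_gt0. Qed.

Lemma ratpow_ge0 a X : 0 <= ratpow a X.
Proof. exact: powR_ge0. Qed.

Lemma ratpow0 a : ratpow a 0 = 1.
Proof. by rewrite /ratpow raddf0 powRr0. Qed.

Lemma ratpow1 a : 0 < a -> ratpow a 1 = a.
Proof. by move=> a0; rewrite /ratpow rmorph1 powRr1// ltW. Qed.

Lemma ratpowD a X Y : 0 < a -> ratpow a (X + Y) = ratpow a X * ratpow a Y.
Proof. by move=> a0; rewrite /ratpow rmorphD powRD// (gt_eqF a0) implybT. Qed.

Lemma ratpowM a b X : 0 < a -> 0 < b -> ratpow (a * b) X = ratpow a X * ratpow b X.
Proof. by move=> a0 b0; rewrite /ratpow powRM// ltW. Qed.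

Lemma ratpow_nat a n : 0 < a -> ratpow a n%:R = a ^+ n.
Proof. by move=> a0; rewrite /ratpow ratr_nat powR_mulrn// ltW. Qed.

Lemma ratpowX a X n : ratpow a X ^+ n = ratpow a (n%:R * X).
Proof. by rewrite /ratpow (mulrC n%:R) rmorphM/= ratr_nat [RHS]powRrM [RHS]powR_mulrn ?powR_ge0. Qed.

Lemma ratpow_ge1_mono a X Y : 1 <= a -> X <= Y -> ratpow a X <= ratpow a Y.
Proof. by move=> a1 XY; rewrite ler_powR// ler_rat. Qed.

Lemma ratpow_le1_anti a X Y : 0 < a -> a <= 1 -> X <= Y -> ratpow a Y <= ratpow a X.
Proof. by move=> a0 a1 XY; rewrite ger_powR ?a0// ler_rat. Qed.

Lemma ratpow_cvg0 (c r eps : R) : 0 <= c -> 0 < r -> r < 1 -> 0 < eps ->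
  exists X0, forall X, X0 <= X -> c * ratpow r X < eps.
Proof.
move=> c0 r0 r1 eps0.
have := @cvg_geometric R c r; rewrite gtr0_norm// => /(_ r1)/cvgr0Pnorm_lt/(_ _ eps0)[N _ hN].
exists N%:R => X NX; apply: le_lt_trans (hN N (leqnn N)).
rewrite /geometric/= ger0_norm ?mulr_ge0 ?exprn_ge0 ?(ltW r0)//.
by rewrite ler_wpM2l// -ratpow_nat// ratpow_le1_anti// ltW.
Qed.

End RationalPower.

(** * Weights of monomials *)

Section Weight.
Variables (d e : nat).
Hypotheses (e_gt0 : (0 < e)%N) (e_lt_d : (e < d)%N).
Local Notation wt := (weight d e).
Local Notation q := (d%:R / e%:R : rat).
Implicit Types (m k n : monomial) (X : rat).

Lemma ratio_gt1 : 1 < q.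
Proof. by rewrite ltr_pdivlMr ?ltr0n// mul1r ltr_nat. Qed.

Lemma ratio_gt0 : 0 < q.
Proof. exact: lt_trans ltr01 ratio_gt1. Qed.

Lemma ratio_ge1X i : 1 <= q ^+ i.
Proof. by rewrite exprn_ege1// ltW// ratio_gt1. Qed.

Lemma ratio_geX i : (0 < i)%N -> q <= q ^+ i.
Proof. by case: i => // i _; rewrite exprS ler_peMr ?ratio_ge1X// ltW// ratio_gt0. Qed.

Lemma ratio_mulXS i : e%:R * q ^+ i.+1 = d%:R * q ^+ i.
Proof. by rewrite exprS mulrA mulrCA divff ?mulr1// pnatr_eq0 -lt0n. Qed.

Lemma weight_widen N m : (size m <= N)%N -> wt m = \sum_(i < N) (m`_i)%R%:R * q ^+ i.
Proof.
move=> mN; rewrite /weight (big_ord_widen N (fun i => (m`_i)%R%:R * q ^+ i)) //.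
rewrite big_mkcond; apply: eq_bigr => i _; case: ltnP => // im.
by rewrite nth_default// mul0r.
Qed.

Lemma weightD m k : wt (m + k) = wt m + wt k.
Proof.
rewrite !(@weight_widen (maxn (size m) (size k))) ?leq_maxl ?leq_maxr ?size_polyD//.
rewrite -big_split; apply: eq_bigr => i _.
by rewrite /= coefD -mulrDl; congr (_ * _); exact: natrD.
Qed.

Lemma weight0 : wt 0 = 0.
Proof. by rewrite /weight size_poly0 big_ord0. Qed.

Lemma weightMn m c : wt (m *+ c) = c%:R * wt m.
Proof.
elim: c => [|c IH]; first by rewrite mulr0n weight0 mul0r.
by rewrite mulrS weightD IH -nat1r mulrDl mul1r.
Qed.

Lemma weight_var i : wt 'X^i = q ^+ i.
Proof.
rewrite (@weight_widen i.+1) ?size_polyXn// big_ord_recr/= coefXn eqxx mul1r big1 ?add0r// => j _.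
by rewrite coefXn ltn_eqF ?mul0r// ltn_ord.
Qed.

Lemma weight_ge0 m : 0 <= wt m.
Proof. by apply: sumr_ge0 => i _; rewrite mulr_ge0// exprn_ge0// ltW// ratio_gt0. Qed.

Lemma mon_sub_varK m i c : (c <= (m`_i)%R)%N -> mon_sub m ('X^i *+ c) + 'X^i *+ c = m.
Proof.
move=> cm; rewrite addrC mon_subK//.
by apply/mon_leP => j; rewrite coefMn coefXn; case: eqP => [->|_];
  rewrite ?mulr1n ?mul0rn// -mulr_natl mulr1 natn.
Qed.

Lemma weight_split m i c : (c <= (m`_i)%R)%N -> wt m = wt (mon_sub m ('X^i *+ c)) + c%:R * q ^+ i.
Proof. by move=> cm; rewrite -{1}(mon_sub_varK cm) weightD weightMn weight_var. Qed.

Definition mdeg m : nat := \sum_(i < size m) (m`_i)%R.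

Lemma mdeg_widen N m : (size m <= N)%N -> mdeg m = (\sum_(i < N) (m`_i)%R)%N.
Proof.
move=> mN; rewrite /mdeg (big_ord_widen N (fun i => (m`_i)%R : nat)) //.
rewrite [LHS]big_mkcond; apply: eq_bigr => i _; case: ltnP => // im.
by rewrite nth_default.
Qed.

Lemma mdegD m k : mdeg (m + k) = (mdeg m + mdeg k)%N.
Proof.
rewrite !(@mdeg_widen (maxn (size m) (size k))) ?leq_maxl ?leq_maxr ?size_polyD//.
by rewrite -big_split; apply: eq_bigr => i _; rewrite coefD.
Qed.

Lemma mdeg_varMn i c : mdeg ('X^i *+ c) = c.
Proof.
rewrite (@mdeg_widen i.+1); last first.
  by apply/leq_sizeP => j ij; rewrite coefMn coefXn gtn_eqF// mul0rn.
rewrite big_ord_recr/= coefMn coefXn eqxx big1 => [|j _].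
  by rewrite -mulr_natl mulr1 natn.
by rewrite coefMn coefXn ltn_eqF ?mul0rn// ltn_ord.
Qed.

Lemma mdeg_le_weight m : (mdeg m)%:R <= wt m.
Proof. by rewrite natr_sum; apply: ler_sum => i _; rewrite ler_peMr// ratio_ge1X. Qed.

Lemma weight_coef_le m i : (m`_i)%R%:R * q ^+ i <= wt m.
Proof. by rewrite (@weight_split m i (m`_i)%R)// lerDr weight_ge0. Qed.

Lemma weight_gt1 m : m != 0 -> m != 'X^0 -> 1 < wt m.
Proof.
move=> m0 m1.
have [[i i0 mi]|mi] := pselect (exists2 i, (0 < i)%N & (0 < (m`_i)%R)%N).
  apply: lt_le_trans (weight_coef_le m i); apply: (lt_le_trans ratio_gt1).
  rewrite (le_trans (ratio_geX i0))// ler_peMl ?(le_trans ler01 (ratio_ge1X _))//.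
  by rewrite ler1n.
have mC : m = 'X^0 *+ (m`_0)%R.
  apply/polyP => -[|i]; rewrite coefMn coefXn; first by rewrite -mulr_natl mulr1 natn.
  rewrite mul0rn; apply/eqP; rewrite -leqn0 leqNgt; apply/negP => h.
  by apply: mi; exists i.+1.
move: mC m0 m1; case: (m`_0)%R => [|[|c]] ->; rewrite ?mulr0n ?mulr1n ?eqxx//.
by rewrite weightMn weight_var expr0 mulr1 ltr1n.
Qed.

Lemma weight_gt0 m : m != 0 -> 1 <= wt m.
Proof.
have [->|m1] := eqVneq m 'X^0; first by rewrite weight_var expr0.
by move=> m0; rewrite ltW// weight_gt1.
Qed.

(** Since d/e > 1, some power [q ^+ N] exceeds [X], so only w_0, ..., w_{N-1} can occur; every
    variable weighs at least 1, so every exponent is at most [X]. *)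
Lemma finite_weight X : finite_set [set m | wt m <= X].
Proof.
have [N hN] : exists N : nat, X < q ^+ N.
  (* Bernoulli's inequality [1 + N (q - 1) <= q ^+ N] reduces this to the archimedean property. *)
  have [N hN] : exists N : nat, 1 + N%:R * (q - 1) > X.
    have [N hN] : exists N : nat, X / (q - 1) < N%:R.
      by exists (Num.bound `|X / (q - 1)|); rewrite (le_lt_trans (ler_norm _)) ?archi_boundP.
    by exists N; move: hN; rewrite ltr_pdivrMr ?subr_gt0 ?ratio_gt1// => /lt_trans; apply; rewrite ltrDr.
  exists N; apply: lt_le_trans hN _; elim: N => [|N IH]; first by rewrite mul0r addr0.
  rewrite exprS; apply: le_trans (_ : q * (1 + N%:R * (q - 1)) <= _).
    have := ratio_gt1; set a := q => a1; rewrite -natr1.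
    have N0 : 0 <= N%:R :> rat by [].
    have : 0 <= N%:R * (a - 1) * (a - 1) by rewrite !mulr_ge0// subr_ge0 ltW.
    lra.
  by rewrite ler_pM2l// ratio_gt0.
(* Every monomial of weight at most [X] divides [M]. *)
pose M : monomial := \poly_(i < N) Num.bound X.
apply: (@sub_finite_set _ _ [set` mon_divisors M]) => [m /= mX|]; last exact: finite_seq.
rewrite mem_mon_divisors; apply/mon_leP => i; rewrite coef_poly.
have := le_trans (weight_coef_le m i) mX.
case: ltnP => [iN h|Ni h].
  have X0 : 0 <= X by rewrite (le_trans (weight_ge0 m)).
  rewrite -(ler_nat rat); apply: le_trans (ltW (archi_boundP X0)); apply: le_trans h.
  by rewrite ler_peMr// ratio_ge1X.
case mi : (m`_i)%R => [//|c]; rewrite mi in h.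
have : q ^+ N <= X.
  apply: le_trans h; apply: (@le_trans _ _ (q ^+ i)).
    by rewrite ler_weXn2l// ltW// ratio_gt1.
  by rewrite ler_peMl ?ler1n// (le_trans ler01 (ratio_ge1X _)).
by rewrite leNgt hN.
Qed.

Definition monomials_upto X : {fset monomial} := fset_set [set m | wt m <= X].

Lemma mem_monomials_upto X m : (m \in monomials_upto X) = (wt m <= X).
Proof.
rewrite in_fset_set; last exact: finite_weight.
by apply/idP/idP => [/set_mem//|h]; exact: mem_set.
Qed.

(** Weights are rational, so well-foundedness comes from finiteness: the induction is on the number
    of monomials strictly lighter than [m]. *)
Lemma weight_ind (P : monomial -> Prop) :
  (forall m, (forall k, wt k < wt m -> P k) -> P m) -> forall m, P m.
Proof.
move=> IH m.
pose below k := [fset j in monomials_upto (wt k) | wt j < wt k]%fset.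
elim: {m}_.+1 {-2}m (ltnSn #|` below m|) => // N IHN m mN.
apply: IH => k km; apply: IHN; rewrite ltnS in mN; apply: leq_trans mN.
apply: fproper_ltn_card; rewrite fproperEneq; apply/andP; split.
  apply/eqP => /fsetP/(_ k); rewrite !inE/= !mem_monomials_upto ltxx andbF.
  by rewrite km ltW.
apply/fsubsetP => j; rewrite !inE/= !mem_monomials_upto => /andP[_ jk].
by rewrite (lt_trans jk km) ltW// (lt_trans jk km).
Qed.

End Weight.

(** * Normal forms of monomials *)

Section NormalForm.
Variables (R : realType) (K : fieldType) (v : nonarch_absval R K).
Variables (d e : nat) (C : R) (f g : {poly K}).
Hypotheses (e_gt0 : (0 < e)%N) (e_lt_d : (e < d)%N) (C_ge1 : 1 <= C).
Hypotheses (f_bound : forall j, (j <= d)%N -> v f`_j <= C ^+ (d - j))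
           (g_bound : forall j, (j <= e)%N -> v g`_j <= C ^+ (e - j)).
Local Notation wt := (weight d e).
Local Notation q := (d%:R / e%:R : rat).
Implicit Types (m k n : monomial) (X : rat).

(* The relation solved for w_{i+1}^e; every term on the right has total degree
   > e, and weight at least that of w_{i+1}^e. *)
Definition rewrite_terms i : seq (K * monomial) :=
  [seq (g`_j, 'X^i *+ d + 'X^(i.+1) *+ (e - j)) | j <- iota 0 e.+1] ++
  [seq (- f`_j, 'X^(i.+1) *+ e + 'X^i *+ (d - j)) | j <- iota 0 d].

Lemma C_gt0 : 0 < C. Proof. exact: lt_le_trans ltr01 C_ge1. Qed.

Lemma expr_le_ratpow j X : j%:R <= X -> C ^+ j <= ratpow C X.
Proof. by move=> jX; rewrite -ratpow_nat ?C_gt0// ratpow_ge1_mono. Qed.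

(** In the terms coming from [g] the factor w_i^d alone has degree d > e. In those coming from [f]
    the index j = d is left out, so w_i occurs besides w_{i+1}^e. *)
Lemma mdeg_rewrite_terms i t : t \in rewrite_terms i -> (e < mdeg t.2)%N.
Proof.
rewrite mem_cat => /orP[] /mapP[j] + -> /=; rewrite mem_iota add0n mdegD !mdeg_varMn.
  by move=> _; rewrite ltn_addr.
by move=> /= jd; rewrite -[ltnLHS]addn0 ltn_add2l subn_gt0.
Qed.

Lemma weight_rewrite_terms i t : t \in rewrite_terms i -> e%:R * q ^+ i.+1 <= wt t.2.
Proof.
have w0 j m : 0 <= wt (m *+ j) by exact: weight_ge0.
rewrite mem_cat => /orP[] /mapP[j] _ -> /=;
  rewrite weightD// ?[wt (_ *+ d)]weightMn// ?[wt ('X^_ *+ e)]weightMn//.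
  by rewrite weight_var// -ratio_mulXS// lerDl w0.
by rewrite weight_var// lerDl w0.
Qed.

(** The term of g_j is heavier than w_{i+1}^e by (e-j)(d/e)^(i+1), that of f_j by (d-j)(d/e)^i.
    These excesses are at least the exponents e-j and d-j of [C] in the coefficient bounds. *)
Lemma absval_rewrite_terms i t : t \in rewrite_terms i ->
  v t.1 <= ratpow C (wt t.2 - e%:R * q ^+ i.+1).
Proof.
rewrite mem_cat => /orP[] /mapP[j]; rewrite mem_iota add0n => /= jn ->/=;
  rewrite weightD// !weightMn// !weight_var//.
  rewrite -ratio_mulXS// [X in X - _]addrC addrK (le_trans (g_bound _))//.
  by apply: expr_le_ratpow; rewrite ler_peMr// ratio_ge1X.
rewrite addrAC subrr add0r absvalN (le_trans (f_bound (ltnW jn)))//.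
by apply: expr_le_ratpow; rewrite ler_peMr// ratio_ge1X.
Qed.

Definition normal_monomial m := forall i, (0 < i)%N -> ((m`_i)%R < e)%N.

(* Each step raises the total degree, which is at most the weight, so the
   coefficient of [n] is reached once the fuel [N] exceeds the weight of [n]. *)
Fixpoint nf_fuel (N : nat) m n : K :=
  if [pick i : 'I_(size m) | (e <= (m`_i.+1)%R)%N] is Some i then
    if N is N'.+1 then
      \sum_(t <- rewrite_terms i) t.1 * nf_fuel N' (mon_sub m ('X^(i.+1) *+ e) + t.2) n
    else 0
  else (m == n)%:R.

Lemma nf_fuel_normal N m n : normal_monomial m -> nf_fuel N m n = (m == n)%:R.
Proof.
by move=> mn; case: N => [|N] /=; case: pickP => // i; rewrite leqNgt mn.
Qed.

Lemma nf_fuel_reducible m : ~ normal_monomial m ->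
  exists i, [/\ (e <= (m`_i.+1)%R)%N, forall n, nf_fuel 0 m n = 0 &
    forall N n, nf_fuel N.+1 m n =
      \sum_(t <- rewrite_terms i) t.1 * nf_fuel N (mon_sub m ('X^(i.+1) *+ e) + t.2) n].
Proof.
move=> mn; case pm : [pick i : 'I_(size m) | (e <= (m`_i.+1)%R)%N] => [i|].
  exists i; split => [|n|N n]; rewrite /= ?pm//.
  by move: pm; case: pickP => // j ej [<-].
exfalso; apply: mn => -[|i]// _; rewrite ltnNge; apply/negP => ei.
move: pm; case: pickP => // /(_ _)/negP h _.
have im : (i < size m)%N.
  by rewrite ltnNge; apply/negP => mi; move: ei;
    rewrite nth_default ?leqW// leqn0 -[_ == _]negbK -lt0n e_gt0.
exact: (h (Ordinal im)).
Qed.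

Lemma weight_reduce i m t : (e <= (m`_i.+1)%R)%N -> t \in rewrite_terms i ->
  wt m <= wt (mon_sub m ('X^(i.+1) *+ e) + t.2).
Proof.
move=> em ti; rewrite weightD// [wt m in leLHS](weight_split _ _ em)//.
by rewrite lerD2l weight_rewrite_terms.
Qed.

Lemma mdeg_reduce i m t : (e <= (m`_i.+1)%R)%N -> t \in rewrite_terms i ->
  (mdeg m < mdeg (mon_sub m ('X^(i.+1) *+ e) + t.2)%R)%N.
Proof.
move=> em ti; rewrite -{1}(mon_sub_varK em) !mdegD mdeg_varMn ltn_add2l.
exact: mdeg_rewrite_terms ti.
Qed.

Lemma nf_fuel_light N m n : wt n < wt m -> nf_fuel N m n = 0.
Proof.
elim: N m => [|N IH] m nm; have [mn|mn] := pselect (normal_monomial m).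
- by rewrite nf_fuel_normal//; case: eqP => // mE; move: nm; rewrite mE ltxx.
- by have [i [_ ->]] := nf_fuel_reducible mn.
- by rewrite nf_fuel_normal//; case: eqP => // mE; move: nm; rewrite mE ltxx.
have [i [em _ ->]] := nf_fuel_reducible mn.
rewrite big_seq big1// => t ti; rewrite IH ?mulr0//.
exact: lt_le_trans nm (weight_reduce em ti).
Qed.

Lemma nf_fuel_heavy N m n : wt n < (mdeg m)%:R -> nf_fuel N m n = 0.
Proof. by move=> nm; rewrite nf_fuel_light// (lt_le_trans nm)// mdeg_le_weight. Qed.

(** A branch that exhausts its fuel has reached total degree at least [N + mdeg m], hence a weight
    above that of [n]. It contributes nothing to the coefficient of [n], in agreement with the
    default value 0. *)
Lemma nf_fuel_stable N N' m n : wt n < (N + mdeg m)%:R -> wt n < (N' + mdeg m)%:R ->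
  nf_fuel N m n = nf_fuel N' m n.
Proof.
elim: N N' m => [|N IH] N' m nN nN'.
  by rewrite !nf_fuel_heavy.
case: N' nN' => [|N'] nN'; first by rewrite !nf_fuel_heavy.
have [mn|mn] := pselect (normal_monomial m); first by rewrite !nf_fuel_normal.
have [i [em _ E]] := nf_fuel_reducible mn; rewrite !E.
apply: eq_big_seq => t ti; congr (_ * _).
have h := mdeg_reduce em ti.
by apply: IH; [apply: lt_le_trans nN _|apply: lt_le_trans nN' _]; rewrite ler_nat addSnnS leq_add2l.
Qed.

(** The estimate telescopes: a rewriting step multiplies by a coefficient of size at most [C] to the
    power of the weight gained. *)
Lemma absval_nf_fuel N m n : v (nf_fuel N m n) <= ratpow C (wt n - wt m).
Proof.
elim: N m => [|N IH] m; have [mn|mn] := pselect (normal_monomial m).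
- rewrite nf_fuel_normal//; case: eqP => [->|_]; rewrite ?absval0 ?ratpow_ge0//.
  by rewrite absval1 subrr ratpow0.
- by have [i [_ -> _]] := nf_fuel_reducible mn; rewrite absval0 ratpow_ge0.
- rewrite nf_fuel_normal//; case: eqP => [->|_]; rewrite ?absval0 ?ratpow_ge0//.
  by rewrite absval1 subrr ratpow0.
have [i [em _ ->]] := nf_fuel_reducible mn.
apply: absval_sum_le => [|t ti _]; first exact: ratpow_ge0.
rewrite absvalM; apply: le_trans
  (ler_pM (absval_ge0 _ _) (absval_ge0 _ _) (absval_rewrite_terms ti) (IH _)) _.
rewrite -ratpowD ?C_gt0// ratpow_ge1_mono// weightD//.
by rewrite [wt m in leRHS](weight_split _ _ em)//; lra.
Qed.

Definition nf_coef m n : K := nf_fuel (Num.bound (wt n)) m n.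

Lemma weight_lt_bound n : wt n < (Num.bound (wt n))%:R.
Proof. by rewrite archi_boundP// weight_ge0. Qed.

Lemma nf_coef_normal m n : normal_monomial m -> nf_coef m n = (m == n)%:R.
Proof. exact: nf_fuel_normal. Qed.

Lemma nf_coef_light m n : wt n < wt m -> nf_coef m n = 0.
Proof. exact: nf_fuel_light. Qed.

Lemma nf_coef_heavy m n : wt n < (mdeg m)%:R -> nf_coef m n = 0.
Proof. exact: nf_fuel_heavy. Qed.

Lemma absval_nf_coef m n : v (nf_coef m n) <= ratpow C (wt n - wt m).
Proof. exact: absval_nf_fuel. Qed.

Lemma nf_coef_reducible m : ~ normal_monomial m ->
  exists2 i, (e <= (m`_i.+1)%R)%N & forall n, nf_coef m n =
    \sum_(t <- rewrite_terms i) t.1 * nf_coef (mon_sub m ('X^(i.+1) *+ e) + t.2) n.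
Proof.
move=> /nf_fuel_reducible[i [em _ E]]; exists i => // n; rewrite /nf_coef.
have wn := weight_lt_bound n.
have wn' a : wt n < (Num.bound (wt n) + a)%:R by rewrite (lt_le_trans wn)// ler_nat leq_addr.
rewrite (@nf_fuel_stable _ (Num.bound (wt n)).+1) ?E//.
by rewrite (lt_le_trans wn)// ler_nat addSnnS leq_addr.
Qed.

(* Confluence: the left-hand sides w_{i+1}^e are pairwise coprime. *)
Lemma nf_coef_rewrite i k n : nf_coef (k + 'X^(i.+1) *+ e) n =
  \sum_(t <- rewrite_terms i) t.1 * nf_coef (k + t.2) n.
Proof.
(* The induction is on the gap between the weight of [n] and the degree of the monomial, which every
   rewriting narrows. When no gap is left, all coefficients at [n] are 0. *)
have : wt n < (Num.bound (wt n) + mdeg (k + 'X^(i.+1) *+ e)%R)%:R.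
  by rewrite (lt_le_trans (weight_lt_bound n))// ler_nat leq_addr.
elim: (Num.bound _) i k => [|N IH] i k nN.
  rewrite nf_coef_heavy// big_seq big1// => t ti; rewrite nf_coef_heavy ?mulr0//.
  rewrite (lt_le_trans nN)// ler_nat add0n !mdegD mdeg_varMn leq_add2l ltnW//.
  exact: mdeg_rewrite_terms ti.
have coefXMn (a b c : nat) : (('X^a *+ b : monomial)`_c)%R = (if c == a then b else 0)%N.
  by rewrite coefMn coefXn; case: eqP; rewrite ?mul0rn// -mulr_natl mulr1 natn.
have nonnormal : ~ normal_monomial (k + 'X^(i.+1) *+ e).
  by move=> /(_ i.+1 isT); rewrite coefD coefXMn eqxx ltnNge leq_addl.
(* [nf_coef] rewrites at an index [j] of its own choice, which may differ from [i]. *)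
have [j ej ->] := nf_coef_reducible nonnormal.
have [ji|/eqP ji] := eqVneq j i.
  by rewrite ji addrC mon_addK.
rewrite coefD coefXMn eqSS (negPf (introN eqP ji)) addr0 in ej.
have -> : mon_sub (k + 'X^(i.+1) *+ e) ('X^(j.+1) *+ e) =
    mon_sub k ('X^(j.+1) *+ e) + 'X^(i.+1) *+ e.
  by rewrite -{1}(mon_sub_varK ej) addrAC addrC mon_addK.
set k' := mon_sub k _.
have kE : k = k' + 'X^(j.+1) *+ e by rewrite mon_sub_varK.
have IHb l t (m : monomial) : t \in rewrite_terms l -> k + 'X^(i.+1) *+ e = m + 'X^(l.+1) *+ e ->
    wt n < (N + mdeg (m + t.2)%R)%:R.
  move=> tl E; rewrite (lt_le_trans nN)// ler_nat addSnnS leq_add2l E.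
  by rewrite !mdegD mdeg_varMn ltn_add2l (mdeg_rewrite_terms tl).
(* Both powers divide the monomial, so rewriting at [j] and [i] in either order gives the same
   double sum. *)
transitivity (\sum_(t <- rewrite_terms j) \sum_(s <- rewrite_terms i)
    t.1 * (s.1 * nf_coef (k' + t.2 + s.2) n)).
  apply: eq_big_seq => t tj; rewrite -big_distrr/= addrAC IH//.
  by rewrite addrAC; apply: (IHb j) => //; rewrite addrAC -kE.
rewrite exchange_big; apply: eq_big_seq => s si.
rewrite kE addrAC IH; last by rewrite addrAC -kE; exact: (IHb i).
rewrite big_distrr; apply: eq_bigr => t _ /=.
by rewrite mulrCA [k' + t.2 + s.2]addrAC.
Qed.

End NormalForm.

(** * Series graded by weight *)

Section Series.
Variable K : fieldType.
Implicit Types (F G H : fseries K) (m k t : monomial) (a b : K).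

(** A common principle for the two kinds of facts needed about products, vanishing in low weight and
    ultrametric bounds on coefficients: both survive finite sums. *)
Lemma fseries_mul_closed (P Q S : monomial -> K -> Prop) F G :
  (forall m, S m 0) -> (forall m a b, S m a -> S m b -> S m (a + b)) ->
  (forall k t a b, P k a -> Q t b -> S (k + t) (a * b)) ->
  (forall m, P m (F m)) -> (forall m, Q m (G m)) -> forall m, S m ((F * G) m).
Proof.
move=> S0 SD SM PF QG m; rewrite [(F * G) m]fseries_mulE big_seq.
apply: (big_ind (S m)) => // [|k]; first exact: SD.
by rewrite mem_mon_divisors => /mon_subK {1}<-; exact: SM.
Qed.

Lemma fseriesDE F G m : (F + G) m = F m + G m. Proof. by []. Qed.

Lemma fseriesNE F m : (- F) m = - F m. Proof. by []. Qed.

Lemma fseriesBE F G m : (F - G) m = F m - G m. Proof. by []. Qed.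

Definition fmono a t : fseries K := fun m => if m == t then a else 0.

Lemma mconstE a : mconst a = fmono a 0.
Proof. by []. Qed.

Lemma mvarE i : mvar K i = fmono 1 'X^i.
Proof. by apply/funext => m; rewrite /mvar /fmono; case: eqP. Qed.

Lemma fseries_sumE (I : Type) (s : seq I) (P : pred I) (F : I -> fseries K) m :
  (\sum_(i <- s | P i) F i) m = \sum_(i <- s | P i) F i m.
Proof. by elim/big_rec2: _ => // i x y _ <-. Qed.

Lemma fmonoM a b s t : fmono a s * fmono b t = fmono (a * b) (s + t).
Proof.
apply/funext => m; rewrite [LHS]fseries_mulE /fmono.
rewrite (eq_bigr (fun k => if (k == s) && (mon_sub m k == t) then a * b else 0)); last first.
  by move=> k _; do 2 case: eqP => _; rewrite /= ?mulr0 ?mul0r.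
have [->|mst] := eqVneq m (s + t).
  rewrite (bigD1_seq s) ?mon_divisors_uniq ?mem_mon_divisors ?mon_le_addr//= mon_addK !eqxx/=.
  by rewrite big1 ?addr0// => k /negPf ->.
rewrite big_seq big1// => k; rewrite mem_mon_divisors => /mon_subK km.
by case: eqP => //= ks; case: eqP => // mt; move: mst; rewrite -km -mt -ks eqxx.
Qed.

Lemma mvarX i c : mvar K i ^+ c = fmono 1 ('X^i *+ c).
Proof.
elim: c => [|c IH]; first by rewrite expr0 mulr0n -mconstE.
by rewrite exprS IH mvarE fmonoM mulr1 mulrS.
Qed.

Lemma mul_mconst a F m : (mconst a * F) m = a * F m.
Proof.
rewrite [LHS]fseries_mulE (bigD1_seq 0) ?mon_divisors_uniq//=; last first.
  by rewrite mem_mon_divisors; apply/mon_leP => i; rewrite coef0.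
rewrite /mconst eqxx big1 ?addr0.
  by congr (_ * F _); rewrite -[RHS](mon_addK m 0) add0r.
by move=> k /negPf ->; rewrite mul0r.
Qed.

Lemma coef_map_mconst (p : {poly K}) i : (map_poly (@mconst K) p)`_i = mconst p`_i.
Proof. by rewrite coef_map_id0//; apply/funext => m; rewrite /mconst; case: eqP. Qed.

End Series.

(** * Weight filtration and coefficient bounds *)

Section WeightFiltration.
Variables (R : realType) (K : fieldType) (v : nonarch_absval R K).
Variables (d e : nat) (C : R).
Hypotheses (e_gt0 : (0 < e)%N) (e_lt_d : (e < d)%N) (C_ge1 : 1 <= C).
Local Notation wt := (weight d e).
Local Notation q := (d%:R / e%:R : rat).
Local Notation upto := (monomials_upto d e).
Implicit Types (F G H : fseries K) (m k n t : monomial) (X s : rat).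

Lemma fseries_mul_upto F G X m : wt m <= X ->
  (F * G) m = \sum_(k <- upto X) \sum_(t <- upto X | k + t == m) F k * G t.
Proof.
move=> mX; rewrite [LHS]fseries_mulE.
have sub k : mon_le k m -> wt k <= X /\ wt (mon_sub m k) <= X.
  move=> /mon_subK km; move: mX; rewrite -{1}km weightD// => h.
  have := weight_ge0 d e k; have := weight_ge0 d e (mon_sub m k); lra.
have inner k : \sum_(t <- upto X | k + t == m) F k * G t =
    if mon_le k m then F k * G (mon_sub m k) else 0.
  case: ifP => [km|/negbT km].
    rewrite -[LHS]big_filter (_ : [seq t <- _ | _] = [:: mon_sub m k]) ?big_seq1//.
    apply/perm_small_eq => //; apply: uniq_perm; rewrite ?filter_uniq ?fset_uniq// => t.
    rewrite mem_filter mem_seq1 mem_monomials_upto//.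
    apply/andP/eqP => [[/eqP <- _]|->]; first by rewrite mon_addK.
    by rewrite mon_subK// eqxx; have [] := sub _ km.
  rewrite big1// => t /eqP E; move: km; rewrite -E mon_le_addr//.
rewrite (eq_bigr _ (fun k _ => inner k)) -big_mkcond -[RHS]big_filter.
apply: perm_big; apply: uniq_perm; rewrite ?mon_divisors_uniq ?filter_uniq ?fset_uniq// => k.
rewrite mem_filter mem_mon_divisors mem_monomials_upto//.
by apply/idP/andP => [km|[]//]; split => //; have [] := sub _ km.
Qed.

(** The pairs with [wt (k + t) > X] may be included at will because [phi] vanishes on them, which
    makes the range of summation a full square. The functional [phi] will be a normal form
    coefficient or a truncated evaluation. *)
Lemma sum_fseries_mul F G X (phi : monomial -> K) :
  (forall m, X < wt m -> phi m = 0) ->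
  \sum_(m <- upto X) (F * G) m * phi m =
  \sum_(k <- upto X) \sum_(t <- upto X) F k * G t * phi (k + t).
Proof.
move=> phi0.
transitivity (\sum_(m <- upto X) \sum_(k <- upto X) \sum_(t <- upto X)
    if k + t == m then F k * G t * phi m else 0).
  apply: eq_big_seq => m; rewrite mem_monomials_upto// => mX.
  rewrite (fseries_mul_upto F G mX) big_distrl; apply: eq_bigr => k _ /=.
  by rewrite big_distrl big_mkcond.
rewrite exchange_big; apply: eq_bigr => k _; rewrite exchange_big; apply: eq_bigr => t _ /=.
have [ktX|ktX] := leP (wt (k + t)) X.
  rewrite (bigD1_seq (k + t)) ?mem_monomials_upto ?fset_uniq//=.
  rewrite ifT// big1 ?addr0// => m mkt.
  by rewrite eq_sym (negPf mkt).
rewrite phi0// mulr0 big_seq big1// => m; rewrite mem_monomials_upto// => mX.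
by case: eqP => // ktm; move: ktX; rewrite ktm ltNge mX.
Qed.

Definition weight_ge s F := forall m, wt m < s -> F m = 0.
Definition weight_gt s F := forall m, wt m <= s -> F m = 0.
(** The index [s] behaves like a degree of homogeneity: w_i has index (d/e)^i, a constant of size at
    most C^j has index -j, and indices add under multiplication. *)
Definition coef_bounded s F := forall m, v (F m) <= ratpow C (wt m - s).

Lemma weight_geW s s' F : s' <= s -> weight_ge s F -> weight_ge s' F.
Proof. by move=> ss' Fs m ms; rewrite Fs// (lt_le_trans ms). Qed.

Lemma weight_gtW s F : weight_gt s F -> weight_ge s F.
Proof. by move=> Fs m /ltW/Fs. Qed.

Lemma weight_ge_gt s s' F : s' < s -> weight_ge s F -> weight_gt s' F.
Proof. by move=> ss' Fs m ms; rewrite Fs// (le_lt_trans ms). Qed.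

Lemma weight_geD s F G : weight_ge s F -> weight_ge s G -> weight_ge s (F + G).
Proof. by move=> Fs Gs m ms; rewrite fseriesDE Fs// Gs// addr0. Qed.

Lemma weight_ge_sum s (I : eqType) (r : seq I) (P : pred I) (F : I -> fseries K) :
  (forall i, P i -> weight_ge s (F i)) -> weight_ge s (\sum_(i <- r | P i) F i).
Proof.
by move=> h; apply: (big_ind (weight_ge s)) => // F0 G0; exact: weight_geD.
Qed.

Lemma weight_gtD s F G : weight_gt s F -> weight_gt s G -> weight_gt s (F + G).
Proof. by move=> Fs Gs m ms; rewrite fseriesDE Fs// Gs// addr0. Qed.

Lemma weight_gtN s F : weight_gt s F -> weight_gt s (- F).
Proof. by move=> Fs m ms; rewrite fseriesNE Fs// oppr0. Qed.

Lemma weight_gtB s F G : weight_gt s F -> weight_gt s G -> weight_gt s (F - G).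
Proof. by move=> Fs Gs; exact: weight_gtD (weight_gtN Gs). Qed.

Lemma weight_gt_sum s (I : eqType) (r : seq I) (P : pred I) (F : I -> fseries K) :
  (forall i, P i -> weight_gt s (F i)) -> weight_gt s (\sum_(i <- r | P i) F i).
Proof.
by move=> h; apply: (big_ind (weight_gt s)) => // F0 G0; exact: weight_gtD.
Qed.

Lemma weight_geM s s' F G : weight_ge s F -> weight_ge s' G -> weight_ge (s + s') (F * G).
Proof.
move=> Fs Gs; apply: (@fseries_mul_closed _ (fun m a => wt m < s -> a = 0)
  (fun m a => wt m < s' -> a = 0) (fun m a => wt m < s + s' -> a = 0)) => //.
- by move=> m a b ha hb ms; rewrite ha// hb// addr0.
- move=> k t a b ha hb; rewrite weightD// => ms.
  have [/ha ->|sk] := ltP (wt k) s; first by rewrite mul0r.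
  by rewrite hb ?mulr0//; lra.
Qed.

Lemma weight_gtM s s' F G : weight_gt s F -> weight_ge s' G -> weight_gt (s + s') (F * G).
Proof.
move=> Fs Gs; apply: (@fseries_mul_closed _ (fun m a => wt m <= s -> a = 0)
  (fun m a => wt m < s' -> a = 0) (fun m a => wt m <= s + s' -> a = 0)) => //.
- by move=> m a b ha hb ms; rewrite ha// hb// addr0.
- move=> k t a b ha hb; rewrite weightD// => ms.
  have [/ha ->|sk] := leP (wt k) s; first by rewrite mul0r.
  by rewrite hb ?mulr0//; lra.
Qed.

Lemma weight_ge_fmono s a t : s <= wt t -> weight_ge s (fmono a t).
Proof.
by move=> st m ms; rewrite /fmono; case: eqP => // mt; move: ms; rewrite mt ltNge st.
Qed.

Lemma weight_ge1 : weight_ge 0 (1 : fseries K).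
Proof. by apply: (@weight_ge_fmono 0 1 0); rewrite weight0. Qed.

Lemma weight_geX s F c : weight_ge s F -> weight_ge (c%:R * s) (F ^+ c).
Proof.
move=> Fs; elim: c => [|c IH]; first by rewrite mul0r expr0; exact: weight_ge1.
by rewrite exprS -nat1r mulrDl mul1r; exact: weight_geM.
Qed.

Lemma coef_boundedW s s' F : s' <= s -> coef_bounded s F -> coef_bounded s' F.
Proof.
move=> ss' Fs m; rewrite (le_trans (Fs m))// ratpow_ge1_mono//.
by rewrite lerD2l lerN2.
Qed.

Lemma coef_boundedD s F G : coef_bounded s F -> coef_bounded s G -> coef_bounded s (F + G).
Proof. by move=> Fs Gs m; exact: absvalD_le. Qed.

Lemma coef_boundedB s F G : coef_bounded s F -> coef_bounded s G -> coef_bounded s (F - G).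
Proof. by move=> Fs Gs m; exact: absvalB_le. Qed.

Lemma coef_bounded0 s : coef_bounded s 0.
Proof. by move=> m; rewrite absval0 ratpow_ge0. Qed.

Lemma coef_bounded_sum s (I : eqType) (r : seq I) (P : pred I) (F : I -> fseries K) :
  (forall i, P i -> coef_bounded s (F i)) -> coef_bounded s (\sum_(i <- r | P i) F i).
Proof.
move=> h; apply: (big_ind (coef_bounded s)) => // [|F0 G0]; first exact: coef_bounded0.
exact: coef_boundedD.
Qed.

Let C_gt0 : 0 < C. Proof. exact: lt_le_trans ltr01 C_ge1. Qed.

Lemma coef_boundedM s s' F G : coef_bounded s F -> coef_bounded s' G -> coef_bounded (s + s') (F * G).
Proof.
move=> Fs Gs; apply: (@fseries_mul_closed _ (fun m a => v a <= ratpow C (wt m - s))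
  (fun m a => v a <= ratpow C (wt m - s')) (fun m a => v a <= ratpow C (wt m - (s + s')))) => //.
- by move=> m; rewrite absval0 ratpow_ge0.
- by move=> m a b; exact: absvalD_le.
- move=> k t a b ha hb; rewrite absvalM (le_trans (ler_pM _ _ ha hb)) ?absval_ge0//.
  by rewrite -ratpowD// weightD// opprD addrACA.
Qed.

Lemma coef_bounded_fmono s a t : v a <= ratpow C (wt t - s) -> coef_bounded s (fmono a t).
Proof.
by move=> st m; rewrite /fmono; case: eqP => [->//|_]; rewrite absval0 ratpow_ge0.
Qed.

Lemma coef_bounded1 : coef_bounded 0 (1 : fseries K).
Proof.
apply: (@coef_bounded_fmono 0 1 0).
by rewrite weight0 subrr ratpow0 absval1.
Qed.

Lemma coef_boundedX s F c : coef_bounded s F -> coef_bounded (c%:R * s) (F ^+ c).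
Proof.
move=> Fs; elim: c => [|c IH]; first by rewrite mul0r expr0; exact: coef_bounded1.
by rewrite exprS -nat1r mulrDl mul1r; exact: coef_boundedM.
Qed.

Lemma weight_ge_mconst a : weight_ge 0 (@mconst K a).
Proof. by apply: weight_ge_fmono; rewrite weight0. Qed.

Lemma coef_bounded_mconst j a : v a <= C ^+ j -> coef_bounded (- j%:R) (@mconst K a).
Proof.
by move=> aj; apply: coef_bounded_fmono; rewrite weight0 opprK add0r ratpow_nat.
Qed.

Lemma weight_ge_prod (I : Type) (r : seq I) (F : I -> fseries K) (s : I -> rat) :
  (forall i, weight_ge (s i) (F i)) -> weight_ge (\sum_(i <- r) s i) (\prod_(i <- r) F i).
Proof.
move=> h; elim: r => [|i r IH]; first by rewrite !big_nil; exact: weight_ge1.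
by rewrite !big_cons; exact: weight_geM.
Qed.

Lemma coef_bounded_prod (I : Type) (r : seq I) (F : I -> fseries K) (s : I -> rat) :
  (forall i, coef_bounded (s i) (F i)) -> coef_bounded (\sum_(i <- r) s i) (\prod_(i <- r) F i).
Proof.
move=> h; elim: r => [|i r IH]; first by rewrite !big_nil; exact: coef_bounded1.
by rewrite !big_cons; exact: coef_boundedM.
Qed.

Lemma weight_drop_poly m : (m`_0)%R = 0%N -> wt m = q * wt (drop_poly 1 m).
Proof.
move=> m0; rewrite (@weight_widen _ _ (size m).+1)// big_ord_recl m0 mul0r add0r.
rewrite (@weight_widen _ _ (size m) (drop_poly 1 m)) ?size_drop_poly ?leq_subr//.
rewrite big_distrr; apply: eq_bigr => i _ /=.
by rewrite coef_drop_poly addn1 exprS mulrCA.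
Qed.

Lemma weight_ge_shift s F : weight_ge s F -> weight_ge (s * q) (fseries_shift F).
Proof.
move=> Fs m; rewrite /fseries_shift; case: eqP => // m0; rewrite weight_drop_poly// => ms.
by apply: Fs; rewrite -(ltr_pM2l (ratio_gt0 e_gt0 e_lt_d)) [ltRHS]mulrC.
Qed.

(** The shift multiplies weights by d/e > 1, and thereby enlarges the excess [wt m - s] only where
    that excess is nonnegative; hence the condition that [F] vanish below weight [s]. *)
Lemma coef_bounded_shift s F : weight_ge s F -> coef_bounded s F ->
  coef_bounded (s * q) (fseries_shift F).
Proof.
move=> Fs Fb m; rewrite /fseries_shift; case: eqP => [m0|]; last by rewrite absval0 ratpow_ge0.
have [ms|ms] := ltP (wt (drop_poly 1 m)) s; first by rewrite Fs// absval0 ratpow_ge0.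
apply: le_trans (Fb _) _; rewrite ratpow_ge1_mono// (weight_drop_poly m0) [s * q]mulrC -mulrBr.
by rewrite ler_peMl ?subr_ge0// ltW// ratio_gt1.
Qed.

End WeightFiltration.

(** * Coefficients of the normal form of a series *)

Section NormalFormSeries.
Variables (K : fieldType) (d e : nat) (f g : {poly K}).
Hypotheses (f_monic : f \is monic) (f_deg : size f = d.+1)
  (g_deg : size g = e.+1).
Hypotheses (e_gt0 : (0 < e)%N) (e_lt_d : (e < d)%N).
Local Notation wt := (weight d e).
Local Notation upto := (monomials_upto d e).
Local Notation nf_coef := (nf_coef d e f g).
Implicit Types (F G H : fseries K) (m k n t : monomial) (X : rat).

Lemma path_relE i : path_rel f g i =
  \sum_(j < e.+1) fmono g`_j ('X^i *+ d + 'X^(i.+1) *+ (e - j)) -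
  \sum_(j < d.+1) fmono f`_j ('X^(i.+1) *+ e + 'X^i *+ (d - j)).
Proof.
rewrite /path_rel /correspondence /homog f_deg g_deg !big_distrr/=.
congr (_ - _); apply: eq_bigr => j _;
  by rewrite coef_map_mconst expr1n mulr1 !mvarX mconstE mulrCA !fmonoM add0r !mulr1.
Qed.

(** The sum stops at the weight of [n] because rewriting never lowers weights. It is thus finite for
    every series, with no condition of convergence. *)
Definition nf_series F n : K := \sum_(m <- upto (wt n)) F m * nf_coef m n.

Lemma nf_seriesD F G n : nf_series (F + G) n = nf_series F n + nf_series G n.
Proof. by rewrite -big_split; apply: eq_bigr => m _; rewrite /= -mulrDl. Qed.

Lemma nf_seriesN F n : nf_series (- F) n = - nf_series F n.
Proof. by rewrite -sumrN; apply: eq_bigr => m _; rewrite /= -mulNr. Qed.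

Lemma nf_seriesB F G n : nf_series (F - G) n = nf_series F n - nf_series G n.
Proof. by rewrite nf_seriesD nf_seriesN. Qed.

Lemma nf_series_sum (I : Type) (r : seq I) (F : I -> fseries K) n :
  nf_series (\sum_(i <- r) F i) n = \sum_(i <- r) nf_series (F i) n.
Proof.
elim/big_rec2: _ => [|i x y _ <-]; last exact: nf_seriesD.
by apply: big1 => m _; rewrite mul0r.
Qed.

Lemma nf_series_gt F n : weight_gt d e (wt n) F -> nf_series F n = 0.
Proof.
by move=> Fn; rewrite /nf_series big_seq big1// => m;
  rewrite mem_monomials_upto// => /Fn ->; rewrite mul0r.
Qed.

Lemma nf_series_normal F n : (forall m, F m != 0 -> normal_monomial e m) ->
  nf_series F n = F n.
Proof.
move=> Fn; rewrite /nf_series (bigD1_seq n) ?mem_monomials_upto ?fset_uniq//=.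
have E m : F m * nf_coef m n = F m * (m == n)%:R.
  by have [->|/Fn mn] := eqVneq (F m) 0; rewrite ?mul0r// nf_coef_normal.
rewrite E eqxx mulr1 big1 ?addr0// => m mn.
by rewrite E (negPf mn) mulr0.
Qed.

Lemma nf_series_mul_fmono F a t n : nf_series (F * fmono a t) n =
  \sum_(k <- upto (wt n)) F k * (a * nf_coef (k + t) n).
Proof.
have light m : wt n < wt m -> nf_coef m n = 0 by exact: nf_coef_light.
rewrite /nf_series sum_fseries_mul//; apply: eq_bigr => k _.
rewrite /fmono; have [tn|tn] := leP (wt t) (wt n).
  rewrite (bigD1_seq t) ?mem_monomials_upto ?fset_uniq//= eqxx big1 ?addr0 ?mulrA// => m /negPf ->.
  by rewrite mulr0 mul0r.
rewrite light ?mulr0; last by rewrite weightD// (lt_le_trans tn)// lerDr weight_ge0.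
rewrite big_seq big1// => m; rewrite mem_monomials_upto// => mn.
by case: eqP mn => [->|_ _]; [rewrite leNgt tn|rewrite mulr0 mul0r].
Qed.

(** The cofactor [F] is arbitrary. By linearity in its monomials [k], the claim is that the two
    sides of the rewriting rule, multiplied by [k], have the same normal form, which is the content
    of [nf_coef_rewrite]. *)
Lemma nf_series_path_rel F i n : nf_series (F * path_rel f g i) n = 0.
Proof.
rewrite path_relE mulrBr !big_distrr nf_seriesB !nf_series_sum/=.
under eq_bigr do rewrite nf_series_mul_fmono.
under [X in _ - X]eq_bigr do rewrite nf_series_mul_fmono.
rewrite exchange_big [X in _ - X]exchange_big -sumrB big1// => k _ /=.
rewrite -!big_distrr -mulrBr/=.
have fd : f`_d = 1 by move: f_monic; rewrite monicE lead_coefE f_deg => /eqP.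
(* As [f] is monic, the index j = d yields w_{i+1}^e with coefficient 1, the left-hand side of the
   rewriting rule. *)
rewrite [X in _ - X]big_ord_recr/= fd subnn mulr0n addr0 mul1r nf_coef_rewrite//.
rewrite /rewrite_terms big_cat !big_map.
rewrite -[iota 0 e.+1]/(index_iota 0 e.+1) big_mkord.
rewrite -[d in iota 0 d]subn0 -/(index_iota 0 d) big_mkord /=.
have -> : \sum_(j < d) - f`_j * nf_coef (k + ('X^(i.+1) *+ e + 'X^i *+ (d - j))) n =
    - \sum_(j < d) f`_j * nf_coef (k + ('X^(i.+1) *+ e + 'X^i *+ (d - j))) n.
  by rewrite -sumrN; apply: eq_bigr => j _; rewrite mulNr.
by ring.
Qed.

Lemma nf_series_partial_sums F n : exists N : nat, forall j : nat, (N <= j)%N ->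
  nf_series (partial_sums f g F j) n = nf_series F n.
Proof.
exists (Num.bound (wt n)) => j nj; apply: eq_big_seq => m; rewrite mem_monomials_upto// => mn.
rewrite /partial_sums f_deg g_deg/= ifT// (le_trans mn)//.
by rewrite (le_trans (ltW (weight_lt_bound _ _ n)))// ler_nat.
Qed.

(** In the filtration at [wt n] the difference is a combination of relations plus a series of weight
    above [wt n], and the normal form coefficient at [n] kills both. *)
Lemma eq_Slim_nf (u w : nat -> fseries K) n : eq_Slim f g u w ->
  exists N : nat, forall j : nat, (N <= j)%N -> nf_series (u j) n = nf_series (w j) n.
Proof.
move=> /(_ (wt n))[N hN]; exists N => j /hN[n' [G [[_ _ [h _ hE]] Gn]]].
apply/eqP; rewrite -subr_eq0 -nf_seriesB -[u j - w j](subrK G) nf_seriesD hE.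
rewrite nf_series_sum big1 ?add0r => [|i _]; last exact: nf_series_path_rel.
rewrite nf_series_gt// => m mn; apply/eqP; apply/negP => /negP/Gn.
by rewrite f_deg g_deg ltNge mn.
Qed.

Lemma eq_Slim_nf_eq F G n : eq_Slim f g (partial_sums f g F) (fun=> G) ->
  nf_series F n = nf_series G n.
Proof.
move=> /(@eq_Slim_nf _ _ n)[N hN]; have [N' hN'] := nf_series_partial_sums F n.
by rewrite -(hN' (maxn N N')) ?leq_maxr// hN ?leq_maxl.
Qed.

End NormalFormSeries.

(** * Substitution *)

Section MonomialEval.
Variables (A : comNzRingType) (u : nat -> A).
Implicit Types (m k : monomial).

Lemma monomial_eval_widen N m : (size m <= N)%N ->
  monomial_eval u m = \prod_(i < N) u i ^+ (m`_i)%R.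
Proof.
move=> mN; rewrite /monomial_eval (big_ord_widen N (fun i => u i ^+ (m`_i)%R)) //.
rewrite big_mkcond; apply: eq_bigr => i _; case: ltnP => // im.
by rewrite nth_default.
Qed.

Lemma monomial_evalD m k : monomial_eval u (m + k) = monomial_eval u m * monomial_eval u k.
Proof.
rewrite !(@monomial_eval_widen (maxn (size m) (size k))) ?leq_maxl ?leq_maxr ?size_polyD//.
by rewrite -big_split; apply: eq_bigr => i _; rewrite coefD [LHS]exprD.
Qed.

Lemma monomial_eval0 : monomial_eval u 0 = 1.
Proof. by rewrite /monomial_eval size_poly0 big_ord0. Qed.

Lemma monomial_eval_varMn i c : monomial_eval u ('X^i *+ c) = u i ^+ c.
Proof.
elim: c => [|c IH]; first by rewrite mulr0n monomial_eval0.
rewrite mulrS monomial_evalD IH exprS; congr (_ * _).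
rewrite (@monomial_eval_widen i.+1) ?size_polyXn// big_ord_recr/= coefXn eqxx expr1 big1 ?mul1r// => j _.
by rewrite coefXn ltn_eqF ?expr0// ltn_ord.
Qed.

End MonomialEval.

(* [w_relation f g a x y] is [x^d y^e (g (1/y) - f (1/x))], the relation of the
   correspondence in the coordinates at infinity. *)
Definition w_relation (K : fieldType) (A : comNzRingType) (d e : nat) (f g : {poly K})
    (a : K -> A) (x y : A) : A :=
  x ^+ d * (\sum_(j < e.+1) a g`_j * y ^+ (e - j)) -
  y ^+ e * (\sum_(j < d.+1) a f`_j * x ^+ (d - j)).

Section Substitution.
Variables (K : fieldType) (d e : nat).
Hypotheses (e_gt0 : (0 < e)%N) (e_lt_d : (e < d)%N).
Local Notation wt := (weight d e).
Local Notation q := (d%:R / e%:R : rat).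
Local Notation upto := (monomials_upto d e).
Variable u : nat -> fseries K.
Hypothesis u_ge : forall i, weight_ge d e (q ^+ i) (u i).
Implicit Types (F G H : fseries K) (m k n t : monomial) (X : rat).

Lemma weight_ge_monomial_eval k : weight_ge d e (wt k) (monomial_eval u k).
Proof. by apply: weight_ge_prod => // i; exact: weight_geX. Qed.

Lemma fseries_substE H X m : wt m <= X ->
  fseries_subst H u m = \sum_(k <- upto X) H k * monomial_eval u k m.
Proof.
move=> mX; apply: fsbigTE => k; rewrite mem_monomials_upto// -ltNge => kX.
by rewrite (weight_ge_monomial_eval (le_lt_trans mX kX)) mulr0.
Qed.

Lemma fseries_substD F G : fseries_subst (F + G) u = fseries_subst F u + fseries_subst G u.
Proof.
apply/funext => m; rewrite fseriesDE !(fseries_substE _ (lexx _)) -big_split.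
by apply: eq_bigr => k _; rewrite fseriesDE mulrDl.
Qed.

Lemma fseries_substN F : fseries_subst (- F) u = - fseries_subst F u.
Proof.
apply/funext => m; rewrite fseriesNE !(fseries_substE _ (lexx _)) -sumrN.
by apply: eq_bigr => k _; rewrite fseriesNE mulNr.
Qed.

Lemma fseries_subst_fmono a t : fseries_subst (fmono a t) u = mconst a * monomial_eval u t.
Proof.
apply/funext => m; rewrite mul_mconst (fseries_substE _ (lexx _)) /fmono.
have [tm|mt] := leP (wt t) (wt m).
  rewrite (bigD1_seq t) ?mem_monomials_upto ?fset_uniq//= eqxx big1 ?addr0// => k /negPf ->.
  by rewrite mul0r.
rewrite (weight_ge_monomial_eval mt) mulr0 big_seq big1// => k.
rewrite mem_monomials_upto// => km; case: eqP => [kt|]; last by rewrite mul0r.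
by move: mt; rewrite -kt ltNge km.
Qed.

Lemma fseries_subst_sum (I : Type) (r : seq I) (F : I -> fseries K) :
  fseries_subst (\sum_(i <- r) F i) u = \sum_(i <- r) fseries_subst (F i) u.
Proof.
elim/big_rec2: _ => [|i x y _ <-]; last exact: fseries_substD.
apply/funext => m; rewrite (fseries_substE _ (lexx _)).
by apply: big1 => k _; rewrite mul0r.
Qed.

Lemma fseries_subst_path_rel (f g : {poly K}) i : size f = d.+1 -> size g = e.+1 ->
  fseries_subst (path_rel f g i) u = w_relation d e f g (@mconst K) (u i) (u i.+1).
Proof.
move=> f_deg g_deg; rewrite (path_relE f_deg g_deg) fseries_substD fseries_substN !fseries_subst_sum.
rewrite /w_relation !big_distrr.
by congr (_ - _); apply: eq_bigr => j _;
  rewrite fseries_subst_fmono monomial_evalD !monomial_eval_varMn [LHS]mulrCA.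
Qed.

End Substitution.

Section ShiftLinear.
Variable K : fieldType.

Lemma fseries_shiftB (F G : fseries K) :
  fseries_shift (F - G) = fseries_shift F - fseries_shift G.
Proof.
by apply/funext => m; rewrite fseriesBE /fseries_shift; case: ifP => // _; rewrite subr0.
Qed.

Lemma mul_fmonoE a t (G : fseries K) m :
  (fmono a t * G) m = if mon_le t m then a * G (mon_sub m t) else 0.
Proof.
rewrite [LHS]fseries_mulE /fmono; case: ifP => tm.
  rewrite (bigD1_seq t) ?mem_mon_divisors ?mon_divisors_uniq//= eqxx big1 ?addr0// => k /negPf ->.
  by rewrite mul0r.
rewrite big_seq big1// => k; rewrite mem_mon_divisors; case: eqP => [->|_ _]; rewrite ?tm//.
by rewrite mul0r.
Qed.

End ShiftLinear.

(** * Integrality of the normal series *)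

Section CoefficientBound.
Variables (R : realType) (K : fieldType) (v : nonarch_absval R K).
Variables (d e : nat) (C : R).
Hypotheses (e_gt0 : (0 < e)%N) (e_lt_d : (e < d)%N) (C_ge1 : 1 <= C).
Local Notation wt := (weight d e).
Local Notation q := (d%:R / e%:R : rat).
Local Notation wge := (weight_ge d e).
Local Notation wgt := (weight_gt d e).
Local Notation bounded := (coef_bounded v d e C).
Implicit Types (F G H x y w : fseries K) (m k n t : monomial) (s : rat).

Lemma weight_ge_powB s s' x y c : wge s x -> wge s y -> wge s' (x - y) ->
  wge (s' + c%:R * s) (x ^+ c.+1 - y ^+ c.+1).
Proof.
move=> xs ys xys; rewrite subrXX; apply: weight_geM => //.
apply: weight_ge_sum => i _ /=.
have -> : c%:R = (c - i)%:R + i%:R :> rat.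
  by rewrite -natrD subnK// -ltnS ltn_ord.
by rewrite mulrDl; apply: weight_geM => //; exact: weight_geX.
Qed.

Lemma weight_ge_powB0 s x y c : wge 0 x -> wge 0 y -> wge s (x - y) -> wge s (x ^+ c - y ^+ c).
Proof.
case: c => [|c] x0 y0 xy; first by rewrite !expr0 subrr.
by have := weight_ge_powB (c := c) x0 y0 xy; rewrite mulr0 addr0.
Qed.

Lemma weight_gt_powB s x w c : wge s x -> wge s w -> wgt s (x - w) ->
  wgt (c%:R * s) (x ^+ c - w ^+ c).
Proof.
move=> xs ws xw; elim: c => [|c IH]; first by rewrite !expr0 subrr.
have -> : x ^+ c.+1 - w ^+ c.+1 = (x - w) * x ^+ c + (x ^+ c - w ^+ c) * w.
  by rewrite !exprSr; ring.
apply: weight_gtD; first by rewrite -nat1r mulrDl mul1r; apply: weight_gtM => //; exact: weight_geX.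
by rewrite -natr1 mulrDl mul1r; exact: weight_gtM.
Qed.

Lemma weight_gt_mulB s s' x y w z : wge s' y -> wge s w ->
  wgt s (x - w) -> wgt s' (y - z) -> wgt (s + s') (x * y - w * z).
Proof.
move=> ys ws xw yz; have -> : x * y - w * z = (x - w) * y + (y - z) * w by ring.
apply: weight_gtD; first exact: weight_gtM.
by rewrite addrC; exact: weight_gtM.
Qed.

Section Relation.
Variables (f g : {poly K}).
Hypotheses (f_bound : forall j, (j <= d)%N -> v f`_j <= C ^+ (d - j))
           (g_bound : forall j, (j <= e)%N -> v g`_j <= C ^+ (e - j)).

(** Since e (d/e) = d, both x^d and y^e have index d. In the sums, f_j x^(d-j) has index exactly 0,
    and g_j y^(e-j) has index (e-j)(d/e - 1), which is nonnegative. *)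
Lemma coef_bounded_w_relation x y : bounded 1 x -> bounded q y ->
  bounded d%:R (w_relation d e f g (@mconst K) x y).
Proof.
move=> x1 yq; apply: coef_boundedB.
  rewrite -[d%:R]addr0; apply: coef_boundedM => //.
    by rewrite -[d%:R]mulr1; exact: coef_boundedX.
  apply: coef_bounded_sum => j _.
  have je : (j <= e)%N by rewrite -ltnS ltn_ord.
  apply: (@coef_boundedW _ _ _ _ _ _ _ (- (e - j)%:R + (e - j)%:R * q)) => //.
    by rewrite addrC subr_ge0 ler_peMr// ltW// ratio_gt1.
  by apply: coef_boundedM => //; [apply: coef_bounded_mconst; rewrite ?g_bound|exact: coef_boundedX].
rewrite -[d%:R]addr0; apply: coef_boundedM => //.
  have -> : d%:R = e%:R * q by rewrite -[q]expr1 ratio_mulXS// expr0 mulr1.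
  exact: coef_boundedX.
apply: coef_bounded_sum => j _.
have jd : (j <= d)%N by rewrite -ltnS ltn_ord.
rewrite -(addNr (d - j)%:R); apply: coef_boundedM => //.
  by apply: coef_bounded_mconst; rewrite ?f_bound.
by rewrite -{1}[(d - j)%:R]mulr1; exact: coef_boundedX.
Qed.

Lemma weight_ge_sum_powB a s x y N (p : {poly K}) : wge 0 x -> wge 0 y -> wge s (x - y) ->
  wge s (\sum_(j < a) mconst p`_j * x ^+ (N - j) - \sum_(j < a) mconst p`_j * y ^+ (N - j)).
Proof.
move=> x0 y0 xy; rewrite -sumrB; apply: weight_ge_sum => j _.
rewrite -mulrBr -[s]add0r; apply: weight_geM => //; first exact: weight_ge_mconst.
exact: weight_ge_powB0.
Qed.

Lemma weight_ge_sum_pow a x N (p : {poly K}) : wge 0 x ->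
  wge 0 (\sum_(j < a) mconst p`_j * x ^+ (N - j)).
Proof.
move=> x0; apply: weight_ge_sum => j _; rewrite -[0]add0r.
apply: weight_geM => //; first exact: weight_ge_mconst.
by rewrite -[0](mulr0 (N - j)%:R); exact: weight_geX.
Qed.

(** This is the linear approximation of the relation in the direction [F - A]. The derivative of x^d
    gives the main term d w_0^(d-1) (F - A). The variation of y^e is heavier because [F' - A'] has
    weight at least [lam * q], and the factors multiplying x^d and y^e contribute only corrections
    of higher weight. *)
Lemma w_relation_linearize (lam : rat) F F' A A' : 1 < lam ->
  g`_e = 1 -> wgt 1 (F - mvar K 0) -> wgt 1 (A - mvar K 0) -> wge q F' -> wge q A' ->
  wge lam (F - A) -> wge (lam * q) (F' - A') ->
  wgt (d.-1%:R + lam) (w_relation d e f g (@mconst K) F F' - w_relation d e f g (@mconst K) A A'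
    - fmono d%:R ('X^0 *+ d.-1) * (F - A)).
Proof.
move=> lam1 ge1 Fw Aw F'q A'q FA FA'.
have q1 : 1 < q by exact: ratio_gt1.
have w1 : wge 1 (mvar K 0).
  by rewrite mvarE; apply: weight_ge_fmono; rewrite weight_var expr0.
have F1 : wge 1 F by rewrite -[F](subrK (mvar K 0)); apply: weight_geD => //; exact: weight_gtW.
have A1 : wge 1 A by rewrite -[A](subrK (mvar K 0)); apply: weight_geD => //; exact: weight_gtW.
have F0 : wge 0 F by exact: weight_geW F1.
have A0 : wge 0 A by exact: weight_geW A1.
have F'1 : wge 1 F' by apply: weight_geW F'q; exact: ltW.
have F'0 : wge 0 F' by exact: weight_geW F'1.
have A'0 : wge 0 A' by apply: weight_geW A'q.
have le_d1 (i : 'I_d) : (i <= d.-1)%N by rewrite -ltnS prednK ?ltn_ord// (ltn_trans e_gt0).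
have dS : d = d.-1.+1 by rewrite prednK// (ltn_trans e_gt0).
have eS : e = e.-1.+1 by rewrite prednK.
have dE : d%:R = 1 + d.-1%:R :> rat by rewrite {1}dS -nat1r.
have eqd : e%:R * q = d%:R by rewrite -[q]expr1 ratio_mulXS// expr0 mulr1.
rewrite /w_relation.
set hG := fun y : fseries K => \sum_(j < e.+1) mconst g`_j * y ^+ (e - j).
set hF := fun x : fseries K => \sum_(j < d.+1) mconst f`_j * x ^+ (d - j).
rewrite -/(hG F') -/(hG A') -/(hF F) -/(hF A).
set S := \sum_(i < d) F ^+ (d.-1 - i) * A ^+ i.
have SE : F ^+ d - A ^+ d = (F - A) * S.
  by rewrite subrXX.
set T := fmono d%:R ('X^0 *+ d.-1).
(* The first summand compares the cofactor [S] with d w_0^(d-1); the four others collect what must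
   be shown to be heavier than the main term. *)
have -> : F ^+ d * hG F' - F' ^+ e * hF F - (A ^+ d * hG A' - A' ^+ e * hF A) - T * (F - A) =
   (S - T) * (F - A) + (F ^+ d - A ^+ d) * (hG F' - 1) + A ^+ d * (hG F' - hG A')
   - (F' ^+ e - A' ^+ e) * hF F - A' ^+ e * (hF F - hF A).
  have -> : F ^+ d = A ^+ d + (F - A) * S by rewrite -SE addrC subrK.
  by ring.
have FdAd : wge (lam + d.-1%:R) (F ^+ d - A ^+ d).
  by have := weight_ge_powB (c := d.-1) F1 A1 FA; rewrite mulr1 -dS.
have Ad : wge d%:R (A ^+ d) by rewrite -[d%:R]mulr1; exact: weight_geX.
have A'e : wge d%:R (A' ^+ e) by rewrite -eqd; exact: weight_geX.
have lamq : lam < lam * q by rewrite ltr_pMr// (lt_trans ltr01).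
repeat first [apply: weight_gtB | apply: weight_gtD].
- apply: weight_gtM => //.
  (* Written as d copies of w_0^(d-1), [T] can be compared with [S] term by term, [F] and [A] both
     being w_0 up to higher weight. *)
  have -> : T = \sum_(i < d) mvar K 0 ^+ (d.-1 - i) * mvar K 0 ^+ i.
    rewrite (eq_bigr (fun=> fmono 1 ('X^0 *+ d.-1))) => [|i _].
      apply/funext => m; rewrite fseries_sumE sumr_const card_ord /fmono /T /fmono.
      by case: eqP; rewrite ?mul0rn.
    by rewrite -exprD subnK ?mvarX.
  rewrite -sumrB; apply: weight_gt_sum => i _.
  have -> : d.-1%:R = (d.-1 - i)%:R * 1 + i%:R * 1 :> rat.
    by rewrite !mulr1 -natrD subnK.
  by apply: weight_gt_mulB;
    [exact: weight_geX|exact: weight_geX|exact: weight_gt_powB|exact: weight_gt_powB].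
- rewrite [_ + lam]addrC -[lam + _]addr0 addrC [_ * (_ - 1)]mulrC; apply: weight_gtM => //.
  apply: (@weight_ge_gt _ _ _ 1) => //.
  rewrite /hG big_ord_recr/= subnn expr0 mulr1 ge1 addrK.
  apply: weight_ge_sum => j _; rewrite -[1]add0r; apply: weight_geM => //; first exact: weight_ge_mconst.
  apply: (@weight_geW _ _ _ ((e - j)%:R * 1)); last exact: weight_geX.
  by rewrite mulr1 ler1n subn_gt0.
- apply: (@weight_ge_gt _ _ _ (d%:R + lam * q)); first lra.
  by apply: weight_geM => //; exact: weight_ge_sum_powB.
- apply: (@weight_ge_gt _ _ _ (lam * q + e.-1%:R * q + 0)).
    have cq : e.-1%:R * q = d.-1%:R + 1 - q.
      by move: eqd; rewrite dE {1}eS -nat1r mulrDl mul1r => h; lra.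
    (* This product is exactly the excess of [lam * q + e.-1%:R * q] over [d.-1%:R + lam]. *)
    have : 0 < (lam - 1) * (q - 1) by rewrite mulr_gt0 ?subr_gt0.
    have -> : (lam - 1) * (q - 1) = lam * q - lam - q + 1 by ring.
    rewrite cq; set a := q; lra.
  apply: weight_geM => //; last exact: weight_ge_sum_pow.
  by have := weight_ge_powB (c := e.-1) F'q A'q FA'; rewrite -eS.
- apply: (@weight_ge_gt _ _ _ (d%:R + lam)); first lra.
  by apply: weight_geM => //; exact: weight_ge_sum_powB.
Qed.

End Relation.
End CoefficientBound.

(** * Leading terms and coefficient bounds of the two normal series *)

Section NormalSeriesBound.
Variables (R : realType) (K : fieldType) (v : nonarch_absval R K).
Variables (d e : nat) (C : R).
Hypotheses (e_gt0 : (0 < e)%N) (e_lt_d : (e < d)%N) (C_ge1 : 1 <= C).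
Local Notation wt := (weight d e).
Local Notation q := (d%:R / e%:R : rat).
Local Notation upto := (monomials_upto d e).
Local Notation bounded := (coef_bounded v d e C).
Implicit Types (F G H : fseries K) (m k n t : monomial) (s : rat).

(** For monic [p] this says that all roots, in an algebraic closure with the extended absolute
    value, have absolute value at most [C]. *)
Definition coefs_le (p : {poly K}) := forall j, (j <= (size p).-1)%N -> v p`_j <= C ^+ ((size p).-1 - j).

Lemma mon_var_eq0 i : ('X^i == 0 :> monomial) = false.
Proof. by rewrite -size_poly_eq0 size_polyXn. Qed.

(** The monomials 1 and w_0 are the only ones of weight at most 1, so this means that [F] is w_0
    plus terms of weight above 1. *)
Definition leading_w0 F := F 0 = 0 /\ F 'X^0 = 1.

Lemma weight_le1 m : wt m <= 1 -> m = 0 \/ m = 'X^0.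
Proof.
move=> m1; have [->|m0] := eqVneq m 0; [by left|right].
by apply/eqP; apply/negP => /negP mX; move: m1; rewrite leNgt weight_gt1.
Qed.

Lemma leading_w0_ge F : leading_w0 F -> weight_ge d e 1 F.
Proof.
move=> [F0 _] m m1; have [->//|m0] := eqVneq m 0.
by move: m1; rewrite ltNge weight_gt0.
Qed.

Lemma leading_w0_gt F : leading_w0 F -> weight_gt d e 1 (F - mvar K 0).
Proof.
move=> [F0 F1] m /weight_le1[->|->]; rewrite fseriesBE /mvar ?eqxx ?F1 ?subrr//.
by rewrite F0 eq_sym mon_var_eq0 subrr.
Qed.

Lemma orbit_series_ge F i : leading_w0 F -> weight_ge d e (q ^+ i) (orbit_series F i).
Proof.
move=> /leading_w0_ge F1; rewrite /orbit_series; elim: i => [|i IH]; first by rewrite expr0.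
by rewrite exprSr iterS; exact: weight_ge_shift.
Qed.

Lemma orbit_series_bounded F i : leading_w0 F -> bounded 1 F ->
  bounded (q ^+ i) (orbit_series F i).
Proof.
move=> F1 Fb; elim: i => [|i IH]; first by rewrite expr0.
by rewrite exprSr; apply: coef_bounded_shift => //; exact: orbit_series_ge.
Qed.

Lemma normal_monomial_var0 c m : normal_monomial e m -> normal_monomial e ('X^0 *+ c + m).
Proof.
by move=> mn i i0; rewrite coefD coefMn coefXn gtn_eqF// mul0rn add0r mn.
Qed.

Section NormalForm.
Variables (f g : {poly K}).
Hypotheses (f_monic : f \is monic) (f_deg : size f = d.+1)
  (g_deg : size g = e.+1).

Lemma normal_monomial_le1 n : wt n <= 1 -> normal_monomial e n.
Proof.
move=> /weight_le1[->|->] i i0; first by rewrite coef0.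
by rewrite coefXn gtn_eqF.
Qed.

Lemma nf_series_le1 F n : wt n <= 1 -> nf_series d e f g F n = F n.
Proof.
move=> n1; pose G : fseries K := fun m => if wt m <= 1 then F m else 0.
transitivity (nf_series d e f g G n).
  by apply: eq_big_seq => m; rewrite mem_monomials_upto// => mn; rewrite /G (le_trans mn n1).
rewrite nf_series_normal//; first by rewrite /G n1.
by move=> m; rewrite /G; case: ifP => [m1 _|_]; [exact: normal_monomial_le1|rewrite eqxx].
Qed.

(** The normal form does not alter coefficients in weight at most 1, so those of the approximations
    [F_ n], which agree with w_0 there, pass to the limit. *)
Lemma xi_leading_w0 F : is_xi f g F -> leading_w0 F.
Proof.
move=> [_ [F_ [hF_ FF]]].
have lead n : wt n <= 1 -> F n = mvar K 0 n.
  move=> n1; have [N hN] := eq_Slim_nf f_monic f_deg g_deg e_gt0 e_lt_d n FF.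
  have [N' hN'] := nf_series_partial_sums f_deg g_deg e_gt0 e_lt_d F n.
  have := hN (maxn N N') (leq_maxl _ _); rewrite hN' ?leq_maxr// !nf_series_le1// => <-.
  apply/eqP; rewrite -subr_eq0; apply/negP => /negP.
  have [_ + _] := hF_ (maxn N N') => /(_ n) h /h.
  by rewrite f_deg g_deg ltNge n1.
split; rewrite lead ?weight0 ?weight_var ?expr0// /mvar ?eqxx//.
by rewrite eq_sym mon_var_eq0.
Qed.

(** The leading terms of [G] are read off from the identity that [G] at the orbit of [F] is w_0: up
    to weight 1 only the monomials 1 and w_0 of [G] contribute. *)
Lemma gamma_leading_w0 F G : leading_w0 F -> orbits_cancel f g F G -> leading_w0 G.
Proof.
move=> F1 /(_ 0%N)/(eq_Slim_nf_eq f_monic f_deg g_deg e_gt0 e_lt_d) FG.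
have {}FG n : wt n <= 1 -> G 0 * (1 : fseries K) n + G 'X^0 * F n = mvar K 0 n.
  move=> n1; have := FG n; rewrite !nf_series_le1// => <-.
  rewrite (fseries_substE e_gt0 e_lt_d (fun i => orbit_series_ge (i := i) F1) _ n1).
  have -> : \sum_(k <- upto 1) orbit_series G 0 k * monomial_eval (orbit_series F) k n =
      \sum_(k <- [:: 0; 'X^0]) G k * monomial_eval (orbit_series F) k n.
    apply: perm_big; apply: uniq_perm; rewrite ?fset_uniq//.
      by rewrite /= inE eq_sym mon_var_eq0.
    move=> k; rewrite mem_monomials_upto// !inE; apply/idP/orP.
      by move=> /weight_le1[->|->]; [left|right]; rewrite eqxx.
    by case=> /eqP ->; rewrite ?weight0 ?weight_var.
  rewrite !big_cons big_nil addr0 monomial_eval0; congr (_ + _ * _ n).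
  by rewrite -['X^0 in RHS]mulr1n monomial_eval_varMn.
have oneE k : (1 : fseries K) k = (k == 0)%:R by rewrite [LHS]/(mconst 1 k) /mconst; case: eqP.
have [F0 FX] := F1; split.
  have := FG 0; rewrite weight0 ler01 F0 oneE eqxx mulr1 mulr0 addr0 => ->//.
  by rewrite /mvar eq_sym mon_var_eq0.
have := FG 'X^0; rewrite weight_var expr0 lexx FX oneE mon_var_eq0 mulr0 mulr1 add0r => ->//.
by rewrite /mvar eqxx.
Qed.

Hypotheses (f_le : coefs_le f) (g_le : coefs_le g).

Let f_bound j : (j <= d)%N -> v f`_j <= C ^+ (d - j).
Proof. by move: (f_le (j := j)); rewrite f_deg. Qed.

Let g_bound j : (j <= e)%N -> v g`_j <= C ^+ (e - j).
Proof. by move: (g_le (j := j)); rewrite g_deg. Qed.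

Let C_gt0 : 0 < C. Proof. exact: lt_le_trans ltr01 C_ge1. Qed.

Lemma absval_nf_series s F n : bounded s F ->
  v (nf_series d e f g F n) <= ratpow C (wt n - s).
Proof.
move=> Fs; apply: absval_sum_le => [|m _ _]; first exact: ratpow_ge0.
have nfm := absval_nf_coef e_gt0 e_lt_d C_ge1 f_bound g_bound m n.
rewrite absvalM; apply: le_trans
  (ler_pM (absval_ge0 _ _) (absval_ge0 _ _) (Fs m) nfm) _.
by rewrite -ratpowD// addrC addrA subrK.
Qed.

(* Comparing the coefficients of [w_0^(d-1) m] in the relation satisfied by [F]
   expresses [d * F m] through the coefficients of [F] of smaller weight. *)
Lemma coef_bounded_normal (f' g' : {poly K}) F : v d%:R = 1 ->
  g' \is monic -> size f' = d.+1 -> size g' = e.+1 -> coefs_le f' -> coefs_le g' ->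
  leading_w0 F -> (forall m, F m != 0 -> normal_monomial e m) ->
  formal_morphism f g f' g' F -> bounded 1 F.
Proof.
move=> vd g'_monic f'_deg g'_deg f'_le g'_le F1 Fn FF.
have rel0 n : nf_series d e f g (w_relation d e f' g' (@mconst K) F (fseries_shift F)) n = 0.
  rewrite -[F in X in nf_series _ _ _ _ X]/(orbit_series F 0).
  have := eq_Slim_nf_eq f_monic f_deg g_deg e_gt0 e_lt_d n (FF 0%N).
  rewrite (fseries_subst_path_rel e_gt0 e_lt_d (fun i => orbit_series_ge (i := i) F1))// => ->.
  by rewrite nf_series_gt// => m _.
apply: (weight_ind e_gt0 e_lt_d) => m IH.
have [Fm0|Fm0] := eqVneq (F m) 0; first by rewrite Fm0 absval0 ratpow_ge0.
have [m1|m1] := leP (wt m) 1.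
  have [F0 FX] := F1; case: (weight_le1 m1) => ->; first by rewrite F0 absval0 ratpow_ge0.
  by rewrite FX absval1 weight_var expr0 subrr ratpow0.
(* [A] keeps the part of [F] strictly below the weight of [m], to which the induction hypothesis
   applies. *)
pose A : fseries K := fun k => if wt k < wt m then F k else 0.
have A1 : leading_w0 A.
  have [F0 FX] := F1; rewrite /A /leading_w0 weight0 weight_var expr0 m1.
  by rewrite (lt_trans ltr01 m1).
have Ab : bounded 1 A.
  by move=> k; rewrite /A; case: ltP => [/IH//|_]; rewrite absval0 ratpow_ge0.
have FA : weight_ge d e (wt m) (F - A).
  by move=> k km; rewrite fseriesBE /A km subrr.
set n := 'X^0 *+ d.-1 + m.
have nE : wt n = d.-1%:R + wt m by rewrite weightD weightMn weight_var expr0 mulr1.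
have g'e : g'`_e = 1 by move: g'_monic; rewrite monicE lead_coefE g'_deg => /eqP.
have shift_ge G : leading_w0 G -> weight_ge d e q (fseries_shift G).
  by move=> /leading_w0_ge G1; rewrite -[q]mul1r; exact: weight_ge_shift.
have shFA : weight_ge d e (wt m * q) (fseries_shift F - fseries_shift A).
  by rewrite -fseries_shiftB; exact: weight_ge_shift.
(* The relation of [F] has normal form 0, so at [n] the main term of the linearization must cancel
   the relation of [A], whose coefficients are under control. *)
have := w_relation_linearize e_gt0 e_lt_d f' m1 g'e (leading_w0_gt F1) (leading_w0_gt A1)
  (shift_ge _ F1) (shift_ge _ A1) FA shFA.
rewrite -nE => /(nf_series_gt f g e_gt0 e_lt_d); rewrite 2!nf_seriesB rel0 sub0r.
(* Multiplication by w_0 preserves normal monomials, so the main term is its own normal form and its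
   coefficient at [n] is d times that of [F] at [m]. *)
rewrite [X in _ - X](nf_series_normal f g e_gt0 e_lt_d) => [|k]; last first.
  rewrite mul_fmonoE; case: ifP => [/mon_subK {2}<-|_]; last by rewrite eqxx.
  rewrite mulf_eq0 negb_or => /andP[_ h]; apply: normal_monomial_var0; apply: Fn.
  by move: h; rewrite fseriesBE /A; case: ifP => // _; [rewrite subrr eqxx|rewrite subr0].
rewrite mul_fmonoE mon_le_addr mon_addK fseriesBE /A ltxx subr0 => /eqP.
rewrite subr_eq0 => /eqP dF.
rewrite -[v (F m)]mul1r -vd -absvalM -dF absvalN.
have -> : wt m - 1 = wt n - d%:R.
  have dE : d%:R = 1 + d.-1%:R :> rat by rewrite nat1r prednK// (ltn_trans e_gt0).
  by rewrite nE dE; ring.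
apply: absval_nf_series; apply: coef_bounded_w_relation => //.
- by move=> j; have := f'_le j; rewrite f'_deg.
- by move=> j; have := g'_le j; rewrite g'_deg.
- by rewrite -[q]mul1r; apply: coef_bounded_shift => //; exact: leading_w0_ge.
Qed.

End NormalForm.
End NormalSeriesBound.

(** * Evaluation *)

Section Evaluate.
Variables (R : realType) (K : fieldType) (v : nonarch_absval R K).
Hypothesis K_complete : complete_absval v.
Variables (d e : nat) (C r : R).
Hypotheses (e_gt0 : (0 < e)%N) (e_lt_d : (e < d)%N) (C_ge1 : 1 <= C)
  (r_gt0 : 0 < r) (r_lt1 : r < 1).
Local Notation wt := (weight d e).
Local Notation q := (d%:R / e%:R : rat).
Local Notation upto := (monomials_upto d e).
Local Notation bounded := (coef_bounded v d e C).
Implicit Types (F G H : fseries K) (m k n t : monomial) (s X Y : rat) (u w : nat -> K).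

Let C_gt0 : 0 < C. Proof. exact: lt_le_trans ltr01 C_ge1. Qed.

Lemma limit_at_infty_rate (c : R) (h : rat -> K) (y : K) : 0 <= c ->
  (forall X, 1 <= X -> v (h X - y) <= c * ratpow r X) -> limit_at_infty v h y.
Proof.
move=> c0 hc eps eps0; have [X0 hX0] := ratpow_cvg0 c0 r_gt0 r_lt1 eps0.
exists (Num.max 1 X0) => X; rewrite ge_max => /andP[X1 X0X].
by rewrite (le_lt_trans (hc _ X1))// hX0.
Qed.

Definition eval_upto F u X := \sum_(m <- upto X) F m * monomial_eval u m.

Definition eval_lim F u y := limit_at_infty v (eval_upto F u) y.

Lemma sum_upto_widen X Y (h : monomial -> K) : X <= Y ->
  \sum_(m <- upto X) h m = \sum_(m <- upto Y | wt m <= X) h m.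
Proof.
move=> XY; rewrite -[RHS]big_filter; apply: perm_big; apply: uniq_perm;
  rewrite ?filter_uniq ?fset_uniq//.
move=> m; rewrite mem_filter !mem_monomials_upto//.
by apply/idP/andP => [mX|[]//]; split => //; exact: le_trans mX XY.
Qed.

(** The factor 1/C absorbs the growth of the coefficients, and [r < 1] leaves terms of size at most
    a constant times r^weight. *)
Definition fast u := forall i, v (u i) <= ratpow (r / C) (q ^+ i).

Section FixedPoint.
Variable u : nat -> K.
Hypothesis u_fast : fast u.

Lemma absval_monomial_eval m :
  v (monomial_eval u m) <= ratpow C (- wt m) * ratpow r (wt m).
Proof.
have -> : ratpow C (- wt m) * ratpow r (wt m) = ratpow (r / C) (wt m).
  have {1}-> : r = r / C * C by rewrite divfK// gt_eqF.
  rewrite ratpowM ?divr_gt0// mulrCA -ratpowD// addNr ratpow0 mulr1 //.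
rewrite /monomial_eval /weight; elim/big_rec2: _ => [|i x y _ xy].
  by rewrite absval1 ratpow0.
rewrite absvalM ratpowD ?divr_gt0// ler_pM ?absval_ge0//.
by rewrite absvalX -ratpowX lerXn2r ?nnegrE ?absval_ge0 ?ratpow_ge0.
Qed.

Lemma absval_term s F m : bounded s F ->
  v (F m * monomial_eval u m) <= ratpow C (- s) * ratpow r (wt m).
Proof.
move=> Fs; rewrite absvalM.
apply: le_trans
  (ler_pM (absval_ge0 _ _) (absval_ge0 _ _) (Fs m) (absval_monomial_eval m)) _.
rewrite mulrA -ratpowD//.
by rewrite (_ : wt m - s - wt m = - s)//; ring.
Qed.

Lemma eval_uptoB_le s F X Y : bounded s F -> X <= Y ->
  v (eval_upto F u Y - eval_upto F u X) <= ratpow C (- s) * ratpow r X.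
Proof.
move=> Fs XY; rewrite /eval_upto (sum_upto_widen _ XY) (bigID (fun m => wt m <= X))/= addrAC subrr add0r.
apply: absval_sum_le => [|m _]; first by rewrite mulr_ge0 ?ratpow_ge0.
rewrite -ltNge => Xm; rewrite (le_trans (absval_term m Fs))//.
by rewrite ler_wpM2l ?ratpow_ge0// ratpow_le1_anti// ltW.
Qed.

(** The rate depends on [F] only through the index [s]. This uniformity is what makes it possible to
    sum over all the monomials of a series into which another one is substituted. *)
Lemma eval_lim_rate s F y X : bounded s F -> eval_lim F u y ->
  v (eval_upto F u X - y) <= ratpow C (- s) * ratpow r X.
Proof.
move=> Fs Fy.
have [X0 hX0] : exists X0, forall Y, X0 <= Y -> v (eval_upto F u Y - y) < ratpow C (- s) * ratpow r X.
  by apply: Fy; rewrite mulr_gt0 ?ratpow_gt0.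
have hX : X <= Num.max X X0 by rewrite le_max lexx.
have hX' : X0 <= Num.max X X0 by rewrite le_max lexx orbT.
have -> : eval_upto F u X - y = (eval_upto F u (Num.max X X0) - y) -
    (eval_upto F u (Num.max X X0) - eval_upto F u X) by ring.
by apply: absvalB_le; [exact: ltW (hX0 _ _)|exact: eval_uptoB_le].
Qed.

(** Completeness is applied to the partial sums at integral cutoffs; the ultrametric bound on tails
    extends convergence to rational ones. *)
Lemma eval_lim_exists s F : bounded s F -> exists y, eval_lim F u y.
Proof.
move=> Fs; set c := ratpow C (- s).
have c0 : 0 <= c by exact: ratpow_ge0.
have [y hy] : exists y, forall eps : R, 0 < eps -> exists N : nat, forall n : nat,
    (N <= n)%N -> v (eval_upto F u n%:R - y) < eps.
  apply: K_complete => eps eps0.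
  have [X0 hX0] := ratpow_cvg0 c0 r_gt0 r_lt1 eps0.
  exists (Num.bound `|X0|) => a b.
  have X0N : X0 <= (Num.bound `|X0|)%:R.
    by rewrite (le_trans (ler_norm _))// ltW// archi_boundP.
  wlog ab : a b / (b <= a)%N => [hw|] Na Nb.
    have [/hw|/ltnW/hw h] := leqP b a; first exact.
    by rewrite -absvalN opprB; exact: h.
  apply: le_lt_trans (hX0 b%:R _); first by apply: eval_uptoB_le => //; rewrite ler_nat.
  by rewrite (le_trans X0N)// ler_nat.
exists y; apply: (@limit_at_infty_rate (c / r) ) => [|X X1]; first by rewrite divr_ge0// ltW.
have cX : 0 < c / r * ratpow r X by rewrite mulr_gt0 ?divr_gt0 ?ratpow_gt0.
have [N hN] := hy _ cX.
set M := maxn N (Num.bound X).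
have XM : X <= M%:R.
  rewrite (le_trans (ltW (archi_boundP _))) ?(le_trans ler01)//.
  by rewrite ler_nat leq_maxr.
have -> : eval_upto F u X - y = (eval_upto F u M%:R - y) -
    (eval_upto F u M%:R - eval_upto F u X) by ring.
apply: absvalB_le; first by rewrite ltW// hN// leq_maxl.
rewrite (le_trans (eval_uptoB_le Fs XM))// ler_wpM2r ?ratpow_ge0//.
by rewrite ler_pdivlMr// ler_piMr// ltW.
Qed.

Lemma absval_eval_upto s F X : bounded s F -> v (eval_upto F u X) <= ratpow C (- s).
Proof.
move=> Fs; apply: absval_sum_le => [|m _ _]; first exact: ratpow_ge0.
rewrite (le_trans (absval_term m Fs))// ler_piMr ?ratpow_ge0//.
by rewrite -(ratpow0 r) ratpow_le1_anti ?weight_ge0// ltW.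
Qed.

Lemma absval_eval_lim s F y : bounded s F -> eval_lim F u y -> v y <= ratpow C (- s).
Proof.
move=> Fs Fy; have -> : y = eval_upto F u 0 - (eval_upto F u 0 - y) by ring.
apply: absvalB_le; first exact: absval_eval_upto.
by rewrite (le_trans (eval_lim_rate 0 Fs Fy))// ratpow0 mulr1.
Qed.

(** Every term has weight at least 1, hence size at most r/C. As r < 1, the value stays in the open
    disc of radius 1/C. *)
Lemma absval_eval_lim1 F y : bounded 1 F -> weight_ge d e 1 F -> eval_lim F u y -> v y <= r / C.
Proof.
move=> Fb F1 Fy.
have b0 : ratpow C (- 1) * ratpow r 1 = r / C.
  rewrite ratpow1// mulrC; congr (_ * _).
  apply: (mulfI (lt0r_neq0 C_gt0)); rewrite divff ?gt_eqF//.
  by rewrite -{1}(ratpow1 C_gt0) -ratpowD// subrr ratpow0.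
have -> : y = eval_upto F u 1 - (eval_upto F u 1 - y) by ring.
rewrite -b0; apply: absvalB_le; last exact: eval_lim_rate.
apply: absval_sum_le => [|m _ _]; first by rewrite mulr_ge0 ?ratpow_ge0.
have [m1|m1] := ltP (wt m) 1; first by rewrite F1// mul0r absval0 mulr_ge0 ?ratpow_ge0.
rewrite (le_trans (absval_term m Fb))// ler_wpM2l ?ratpow_ge0// ratpow_le1_anti// ltW//.
Qed.

(** The coefficient bound accompanies the limit because the product rule needs a rate of convergence
    for both factors. *)
Definition evaluates F y := (exists s, bounded s F) /\ eval_lim F u y.

Lemma evaluatesD F G y z : evaluates F y -> evaluates G z -> evaluates (F + G) (y + z).
Proof.
move=> [[s Fs] Fy] [[s' Gs] Gz]; split.
  exists (Num.min s s'); apply: coef_boundedD.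
    by apply: (coef_boundedW C_ge1 _ Fs); rewrite ge_min lexx.
  by apply: (coef_boundedW C_ge1 _ Gs); rewrite ge_min lexx orbT.
move=> eps eps0; have [X0 hX0] := Fy _ eps0; have [X1 hX1] := Gz _ eps0.
exists (Num.max X0 X1) => X; rewrite ge_max => /andP[/hX0 h0 /hX1 h1].
have -> : eval_upto (F + G) u X - (y + z) = (eval_upto F u X - y) - (z - eval_upto G u X).
  rewrite /eval_upto; under eq_bigr do rewrite fseriesDE mulrDl.
  by rewrite big_split/=; ring.
by apply: absvalB_lt => //; rewrite -absvalN opprB.
Qed.

Lemma evaluatesN F y : evaluates F y -> evaluates (- F) (- y).
Proof.
move=> [[s Fs] Fy]; split.
  by exists s => m; rewrite fseriesNE absvalN.
move=> eps /Fy[X0 hX0]; exists X0 => X /hX0 h.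
have -> : eval_upto (- F) u X - - y = - (eval_upto F u X - y).
  rewrite /eval_upto; under eq_bigr do rewrite fseriesNE mulNr.
  by rewrite sumrN; ring.
by rewrite absvalN.
Qed.

(** The product of the truncations differs from the truncation of the product by the pairs of
    monomials whose joint weight exceeds [X], and each of these is at most a constant times r^X. *)
Lemma evaluatesM F G y z : evaluates F y -> evaluates G z -> evaluates (F * G) (y * z).
Proof.
move=> [[s Fs] Fy] [[s' Gs] Gz]; split; first by exists (s + s'); exact: coef_boundedM.
set c := ratpow C (- s) * ratpow C (- s').
have c0 : 0 <= c by rewrite mulr_ge0 ?ratpow_ge0.
apply: (limit_at_infty_rate c0) => X X1.
pose phi m := if wt m <= X then monomial_eval u m else 0.
have FGE : eval_upto (F * G) u X =
    \sum_(k <- upto X) \sum_(t <- upto X) F k * G t * phi (k + t).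
  rewrite -sum_fseries_mul//; last by move=> m; rewrite /phi leNgt => ->.
  by apply: eq_big_seq => m; rewrite mem_monomials_upto// /phi => ->.
have -> : eval_upto (F * G) u X - y * z =
    (eval_upto F u X * (eval_upto G u X - z) + (eval_upto F u X - y) * z) -
    (eval_upto F u X * eval_upto G u X - eval_upto (F * G) u X) by ring.
apply: absvalB_le; [apply: absvalD_le|].
- rewrite absvalM /c -mulrA ler_pM ?absval_ge0 ?absval_eval_upto//.
  exact: eval_lim_rate.
- rewrite absvalM /c mulrAC ler_pM ?absval_ge0//; first exact: eval_lim_rate.
  exact: absval_eval_lim Gz.
rewrite FGE big_distrlr/= -sumrB.
apply: absval_sum_le => [|k _ _]; first by rewrite mulr_ge0 ?ratpow_ge0.
rewrite -sumrB; apply: absval_sum_le => [|t _ _]; first by rewrite mulr_ge0 ?ratpow_ge0.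
rewrite /phi mulrACA -monomial_evalD; case: (leP (wt (k + t)) X) => [_|Xkt].
  by rewrite subrr absval0 mulr_ge0 ?ratpow_ge0.
rewrite mulr0 subr0 monomial_evalD mulrACA absvalM.
apply: le_trans
  (ler_pM (absval_ge0 _ _) (absval_ge0 _ _) (absval_term k Fs) (absval_term t Gs)) _.
rewrite mulrACA -[ratpow r _ * _]ratpowD// -weightD ler_wpM2l ?mulr_ge0 ?ratpow_ge0//.
by rewrite ratpow_le1_anti// ltW.
Qed.

Lemma eval_upto_fmono a t X : wt t <= X -> eval_upto (fmono a t) u X = a * monomial_eval u t.
Proof.
move=> tX; rewrite /eval_upto (bigD1_seq t) ?mem_monomials_upto ?fset_uniq//=.
rewrite /fmono eqxx big1 ?addr0// => m /negPf ->.
by rewrite mul0r.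
Qed.

Lemma evaluates_mconst a j : v a <= C ^+ j -> evaluates (mconst a) a.
Proof.
move=> aj; split; first by exists (- j%:R); exact: coef_bounded_mconst.
apply: (@limit_at_infty_rate 0) => // X X1.
rewrite mconstE eval_upto_fmono ?weight0 ?(le_trans ler01)//.
by rewrite monomial_eval0 mulr1 subrr absval0 mul0r.
Qed.

Lemma evaluates1 : evaluates 1 1.
Proof. by apply: (@evaluates_mconst 1 0); rewrite absval1. Qed.

Lemma evaluatesX F y c : evaluates F y -> evaluates (F ^+ c) (y ^+ c).
Proof.
move=> Fy; elim: c => [|c IH]; first exact: evaluates1.
by rewrite !exprS; exact: evaluatesM.
Qed.

Lemma evaluates_sum (I : Type) (a : seq I) (F : I -> fseries K) (y : I -> K) :
  (forall i, evaluates (F i) (y i)) -> evaluates (\sum_(i <- a) F i) (\sum_(i <- a) y i).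
Proof.
move=> Fy; elim: a => [|i a IH]; last by rewrite !big_cons; exact: evaluatesD.
rewrite !big_nil; have := evaluatesD evaluates1 (evaluatesN evaluates1).
by rewrite !subrr.
Qed.

Lemma evaluates_prod (I : Type) (a : seq I) (F : I -> fseries K) (y : I -> K) :
  (forall i, evaluates (F i) (y i)) -> evaluates (\prod_(i <- a) F i) (\prod_(i <- a) y i).
Proof.
move=> Fy; elim: a => [|i a IH]; first by rewrite !big_nil; exact: evaluates1.
by rewrite !big_cons; exact: evaluatesM.
Qed.

Lemma evaluates_w_relation (f g : {poly K}) F G y z :
  (forall j, (j <= d)%N -> v f`_j <= C ^+ (d - j)) ->
  (forall j, (j <= e)%N -> v g`_j <= C ^+ (e - j)) ->
  evaluates F y -> evaluates G z ->
  evaluates (w_relation d e f g (@mconst K) F G) (w_relation d e f g id y z).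
Proof.
move=> f_bound g_bound Fy Gz; apply: evaluatesD; last apply: evaluatesN.
  apply: evaluatesM; first exact: evaluatesX.
  apply: evaluates_sum => j; apply: evaluatesM; last exact: evaluatesX.
  by apply: evaluates_mconst (g_bound _ _); rewrite -ltnS.
apply: evaluatesM; first exact: evaluatesX.
apply: evaluates_sum => j; apply: evaluatesM; last exact: evaluatesX.
by apply: evaluates_mconst (f_bound _ _); rewrite -ltnS.
Qed.

Section OnPath.
Variables (f g : {poly K}).
Hypotheses (f_monic : f \is monic) (f_deg : size f = d.+1)
  (g_deg : size g = e.+1).
Hypotheses (f_bound : forall j, (j <= d)%N -> v f`_j <= C ^+ (d - j))
           (g_bound : forall j, (j <= e)%N -> v g`_j <= C ^+ (e - j)).
Hypothesis u_path : forall i, w_relation d e f g id (u i) (u i.+1) = 0.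

Lemma rewrite_terms_eval i :
  \sum_(t <- rewrite_terms d e f g i) t.1 * monomial_eval u t.2 = u i.+1 ^+ e.
Proof.
have fd : f`_d = 1 by move: f_monic; rewrite monicE lead_coefE f_deg => /eqP.
have := u_path i; rewrite /w_relation [X in _ - _ * X]big_ord_recr/= fd subnn expr0 !mulr1 mulrDr mulr1.
rewrite opprD addrA => /eqP; rewrite subr_eq0 => /eqP <-.
rewrite /rewrite_terms big_cat !big_map.
rewrite -[iota 0 e.+1]/(index_iota 0 e.+1) big_mkord.
rewrite -[d in iota 0 d]subn0 -/(index_iota 0 d) big_mkord !big_distrr /= -sumrN.
congr (_ + _); apply: eq_bigr => j _; rewrite monomial_evalD !monomial_eval_varMn.
  by rewrite mulrCA.
by rewrite mulNr mulrCA.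
Qed.

(** On a path the rewriting rule is a true equation, so the only discrepancy comes from monomials
    [k] heavier than [X]. Such a [k] enters with a coefficient of size at most C^(wt k - wt m) and
    has a value of size at most C^(- wt k) r^X. *)
Lemma monomial_eval_nf m X :
  v (monomial_eval u m - \sum_(n <- upto X) nf_coef d e f g m n * monomial_eval u n) <=
  ratpow C (- wt m) * ratpow r X.
Proof.
have bigm k : X < wt k -> v (monomial_eval u k) <= ratpow C (- wt k) * ratpow r X.
  move=> Xk; rewrite (le_trans (absval_monomial_eval k))//.
  by rewrite ler_wpM2l ?ratpow_ge0// ratpow_le1_anti// ltW.
have : X < (Num.bound `|X| + mdeg m)%:R.
  rewrite (le_lt_trans (ler_norm _))// (lt_le_trans (archi_boundP _))//.
  by rewrite ler_nat leq_addr.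
elim: (Num.bound _) m => [|N IH] m XN.
  have Xm : X < wt m by rewrite (lt_le_trans XN)// mdeg_le_weight.
  rewrite big_seq big1 ?subr0; first exact: bigm.
  move=> n; rewrite mem_monomials_upto// => nX.
  by rewrite nf_coef_heavy ?mul0r// (le_lt_trans nX).
have [mn|mn] := pselect (normal_monomial e m).
  under eq_bigr do rewrite nf_coef_normal//.
  have [mX|Xm] := leP (wt m) X.
    rewrite (bigD1_seq m) ?mem_monomials_upto ?fset_uniq//= eqxx mul1r big1 ?addr0.
      by rewrite subrr absval0 mulr_ge0 ?ratpow_ge0.
    by move=> n nm; rewrite eq_sym (negPf nm) mul0r.
  rewrite big_seq big1 ?subr0; first exact: bigm.
  move=> n; rewrite mem_monomials_upto// => nX.
  by case: eqP => [mE|]; rewrite ?mul0r//; move: Xm; rewrite mE ltNge nX.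
have [i em E] := nf_coef_reducible f g e_gt0 e_lt_d mn.
set m' := mon_sub m _ in E.
have mE : m = m' + 'X^(i.+1) *+ e by rewrite mon_sub_varK.
have -> : monomial_eval u m - \sum_(n <- upto X) nf_coef d e f g m n * monomial_eval u n =
    \sum_(t <- rewrite_terms d e f g i) t.1 * (monomial_eval u (m' + t.2) -
      \sum_(n <- upto X) nf_coef d e f g (m' + t.2) n * monomial_eval u n).
  rewrite {1}mE monomial_evalD monomial_eval_varMn -rewrite_terms_eval big_distrr/=.
  under [X in _ - X]eq_bigr do rewrite E big_distrl/=.
  rewrite exchange_big -sumrB; apply: eq_bigr => t _ /=.
  rewrite mulrBr monomial_evalD mulrCA; congr (_ - _).
  by rewrite big_distrr; apply: eq_bigr => n _ /=; rewrite mulrA.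
apply: absval_sum_le => [|t ti _]; first by rewrite mulr_ge0 ?ratpow_ge0.
have XNt : X < (N + mdeg (m' + t.2)%R)%:R.
  rewrite (lt_le_trans XN)// ler_nat addSnnS leq_add2l.
  exact: mdeg_reduce em ti.
have t1 := absval_rewrite_terms e_gt0 e_lt_d C_ge1 f_bound g_bound ti.
rewrite absvalM; apply: le_trans (ler_pM (absval_ge0 _ _) (absval_ge0 _ _) t1 (IH _ XNt)) _.
rewrite mulrA -ratpowD// [in leRHS]mE !weightD weightMn weight_var//.
by rewrite (_ : _ + - (wt m' + wt t.2) = - (wt m' + e%:R * q ^+ i.+1))//; ring.
Qed.

(** Each monomial may be replaced by its normal form truncated at [X], with an error of the stated
    size; regrouping the result by [n] produces the coefficients [nf_series F n], which are 0. *)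
Lemma eval_upto_nf0 s F X : bounded s F -> (forall n, nf_series d e f g F n = 0) ->
  v (eval_upto F u X) <= ratpow C (- s) * ratpow r X.
Proof.
move=> Fs F0.
have -> : eval_upto F u X = \sum_(m <- upto X) F m * (monomial_eval u m -
    \sum_(n <- upto X) nf_coef d e f g m n * monomial_eval u n).
  under [RHS]eq_bigr do rewrite mulrBr big_distrr/=.
  rewrite sumrB exchange_big/= [X in _ - X]big_seq [X in _ - X]big1 ?subr0// => n.
  rewrite mem_monomials_upto// => nX.
  transitivity (nf_series d e f g F n * monomial_eval u n); last by rewrite F0 mul0r.
  rewrite /nf_series (sum_upto_widen _ nX) big_distrl [RHS]big_mkcond/=.
  apply: eq_bigr => m _; case: (leP (wt m) (wt n)) => [_|nm]; first by rewrite mulrA.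
  by rewrite nf_coef_light// mul0r mulr0.
apply: absval_sum_le => [|m _ _]; first by rewrite mulr_ge0 ?ratpow_ge0.
rewrite absvalM; apply: le_trans
  (ler_pM (absval_ge0 _ _) (absval_ge0 _ _) (Fs m) (monomial_eval_nf m X)) _.
rewrite mulrA -ratpowD//.
by rewrite (_ : wt m - s - wt m = - s)//; ring.
Qed.

Lemma eval_lim_nf0 s F : bounded s F -> (forall n, nf_series d e f g F n = 0) -> eval_lim F u 0.
Proof.
move=> Fs F0; apply: (@limit_at_infty_rate (ratpow C (- s))) => [|X _]; first exact: ratpow_ge0.
by rewrite subr0; exact: eval_upto_nf0.
Qed.

End OnPath.
End FixedPoint.
End Evaluate.

(** * Shift and substitution under evaluation *)

Section Composition.
Variables (R : realType) (K : fieldType) (v : nonarch_absval R K).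
Hypothesis K_complete : complete_absval v.
Variables (d e : nat) (C r : R).
Hypotheses (e_gt0 : (0 < e)%N) (e_lt_d : (e < d)%N) (C_ge1 : 1 <= C)
  (r_gt0 : 0 < r) (r_lt1 : r < 1).
Local Notation wt := (weight d e).
Local Notation q := (d%:R / e%:R : rat).
Local Notation upto := (monomials_upto d e).
Local Notation bounded := (coef_bounded v d e C).
Local Notation eval_upto := (eval_upto d e).
Local Notation eval_lim := (eval_lim v d e).
Local Notation fast := (fast v d e C r).
Implicit Types (F G H : fseries K) (m k n t : monomial) (s X Y : rat) (u w : nat -> K).

Let C_gt0 : 0 < C. Proof. exact: lt_le_trans ltr01 C_ge1. Qed.

Lemma fast_shift u i : fast u -> fast (fun j => u (i + j)%N).
Proof.
move=> uf j; rewrite (le_trans (uf _))// ratpow_le1_anti ?divr_gt0//.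
  by rewrite ler_pdivrMr// mul1r (le_trans (ltW r_lt1)).
by rewrite exprD ler_peMl ?ratio_ge1X// (le_trans ler01)// ratio_ge1X.
Qed.

Lemma monomial_eval_mulX u k :
  monomial_eval u (k * 'X) = monomial_eval (fun j => u j.+1) k.
Proof.
rewrite (@monomial_eval_widen _ _ (size k).+1).
  rewrite big_ord_recl coefMX expr0 mul1r.
  by apply: eq_bigr => i _; rewrite coefMX.
by have [->|k0] := eqVneq k 0; rewrite ?mul0r ?size_poly0// size_mulX.
Qed.

Lemma drop_poly_mulX k : drop_poly 1 (k * 'X) = k.
Proof. by apply/polyP => i; rewrite coef_drop_poly addn1 coefMX. Qed.

(** Shifting a monomial multiplies its weight by d/e, so a cutoff at [X] becomes one at [X / q]
    before the shift. *)
Lemma eval_upto_fseries_shift F u X :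
  eval_upto (fseries_shift F) u X = eval_upto F (fun j => u j.+1) (X / q).
Proof.
have q0 := ratio_gt0 e_gt0 e_lt_d.
have mulX0 k : ((k * 'X)`_0)%R = 0%N by rewrite coefMX.
rewrite /eval_upto (bigID (fun m => (m`_0)%R == 0)%N)/= [X in _ + X]big1 ?addr0; last first.
  by move=> m /negPf m0; rewrite /fseries_shift m0 mul0r.
rewrite -big_filter (perm_big [seq k * 'X | k <- upto (X / q)]); last first.
  apply: uniq_perm; rewrite ?filter_uniq ?fset_uniq//.
    rewrite map_inj_uniq ?fset_uniq// => k k' /(congr1 (drop_poly 1)).
    by rewrite !drop_poly_mulX.
  move=> m; rewrite mem_filter mem_monomials_upto//; apply/andP/mapP.
    move=> [/eqP m0 mX]; exists (drop_poly 1 m).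
      by rewrite mem_monomials_upto// ler_pdivlMr// mulrC -weight_drop_poly.
    apply/polyP => -[|i]; rewrite coefMX ?m0//= coef_drop_poly addn1 //.
  move=> [k]; rewrite mem_monomials_upto// ler_pdivlMr// => kX ->; rewrite mulX0 eqxx; split => //.
  by rewrite weight_drop_poly// drop_poly_mulX mulrC.
rewrite big_map; apply: eq_bigr => k _.
by rewrite /fseries_shift mulX0 eqxx drop_poly_mulX monomial_eval_mulX.
Qed.

Lemma eval_lim_fseries_shift F u y : eval_lim F (fun j => u j.+1) y ->
  eval_lim (fseries_shift F) u y.
Proof.
have q0 := ratio_gt0 e_gt0 e_lt_d.
move=> Fy eps /Fy[X0 hX0]; exists (X0 * q) => X X0X.
by rewrite eval_upto_fseries_shift; apply: hX0; rewrite ler_pdivlMr.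
Qed.

Lemma eval_lim_orbit_series F u i y : eval_lim F (fun j => u (i + j)%N) y ->
  eval_lim (orbit_series F i) u y.
Proof.
elim: i u => [//|i IH] u Fy.
by apply: eval_lim_fseries_shift; apply: IH.
Qed.

Section Subst.
Variables (F G : fseries K) (u y : nat -> K).
Hypotheses (F_lead : leading_w0 F) (F_bounded : bounded 1 F) (G_bounded : bounded 1 G)
  (u_fast : fast u) (Fy : forall i, eval_lim (orbit_series F i) u (y i)).

Let F_ge i : weight_ge d e (q ^+ i) (orbit_series F i).
Proof. exact: orbit_series_ge. Qed.

Lemma bounded_monomial_eval k : bounded (wt k) (monomial_eval (orbit_series F) k).
Proof.
by apply: coef_bounded_prod => // i; apply: coef_boundedX => //; exact: orbit_series_bounded.
Qed.

Lemma bounded_fseries_subst : bounded 1 (fseries_subst G (orbit_series F)).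
Proof.
move=> m; rewrite (fseries_substE e_gt0 e_lt_d F_ge _ (lexx _)).
apply: absval_sum_le => [|k _ _]; first exact: ratpow_ge0.
rewrite absvalM; apply: le_trans
  (ler_pM (absval_ge0 _ _) (absval_ge0 _ _) (G_bounded k) (bounded_monomial_eval k m)) _.
by rewrite -ratpowD// addrC addrA subrK.
Qed.

Lemma eval_lim_monomial_eval k :
  eval_lim (monomial_eval (orbit_series F) k) u (monomial_eval y k).
Proof.
suff [//] : evaluates v d e C u (monomial_eval (orbit_series F) k) (monomial_eval y k).
apply: (evaluates_prod e_gt0 e_lt_d C_ge1 r_gt0 r_lt1 u_fast) => i.
apply: (evaluatesX e_gt0 e_lt_d C_ge1 r_gt0 r_lt1 u_fast); split; last exact: Fy.
by exists (q ^+ i); exact: orbit_series_bounded.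
Qed.

(** Substitution does not lower weights, so truncating the result at [X] amounts to truncating [G]
    and each substituted monomial at [X]. The error at [k] is at most C^(wt k - 1) C^(- wt k) r^X,
    independently of [k]. *)
Lemma eval_upto_fseries_subst X :
  v (eval_upto (fseries_subst G (orbit_series F)) u X - eval_upto G y X) <=
  ratpow C (- 1) * ratpow r X.
Proof.
have -> : eval_upto (fseries_subst G (orbit_series F)) u X - eval_upto G y X =
    \sum_(k <- upto X) G k * (eval_upto (monomial_eval (orbit_series F) k) u X - monomial_eval y k).
  under [RHS]eq_bigr do rewrite mulrBr big_distrr/=.
  rewrite sumrB exchange_big/=; congr (_ - _).
  apply: eq_big_seq => m; rewrite mem_monomials_upto// => mX.
  rewrite (fseries_substE e_gt0 e_lt_d F_ge _ mX) big_distrl.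
  by apply: eq_bigr => k _; rewrite mulrA.
apply: absval_sum_le => [|k _ _]; first by rewrite mulr_ge0 ?ratpow_ge0.
have h := eval_lim_rate e_gt0 e_lt_d C_ge1 r_gt0 r_lt1 u_fast X
  (bounded_monomial_eval k) (eval_lim_monomial_eval k).
rewrite absvalM; apply: le_trans
  (ler_pM (absval_ge0 _ _) (absval_ge0 _ _) (G_bounded k) h) _.
rewrite mulrA -ratpowD//.
by rewrite (_ : wt k - 1 - wt k = - 1)//; ring.
Qed.

End Subst.

Section Conjugacy.
Variables (f g f' g' : {poly K}).
Hypotheses (f_monic : f \is monic) (f_deg : size f = d.+1)
  (g_deg : size g = e.+1)
  (f'_deg : size f' = d.+1) (g'_deg : size g' = e.+1).
Hypotheses (f_le : coefs_le v C f) (g_le : coefs_le v C g)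
  (f'_le : coefs_le v C f') (g'_le : coefs_le v C g').
Variables (F G : fseries K).
Hypotheses (F_lead : leading_w0 F) (F_bounded : bounded 1 F) (G_bounded : bounded 1 G)
  (F_morphism : formal_morphism f g f' g' F) (FG : orbits_cancel f g F G).

Definition w_path (f g : {poly K}) u :=
  fast u /\ forall i, w_relation d e f g id (u i) (u i.+1) = 0.

Lemma w_path_shift f0 g0 u i : w_path f0 g0 u -> w_path f0 g0 (fun j => u (i + j)%N).
Proof.
by move=> [uf ur]; split=> [|j]; [exact: fast_shift|rewrite addnS ur].
Qed.

Let bound (p : {poly K}) N (pN : size p = N.+1) (p_le : coefs_le v C p) j :
  (j <= N)%N -> v p`_j <= C ^+ (N - j).
Proof. by move: (p_le j); rewrite pN. Qed.

Section Path.
Variables (u y : nat -> K).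
Hypotheses (u_path : w_path f g u) (Fy : forall i, eval_lim F (fun j => u (i + j)%N) (y i)).

Let Fy_orbit i : eval_lim (orbit_series F i) u (y i).
Proof. exact: eval_lim_orbit_series. Qed.

Let eval0 s H : bounded s H -> (forall n, nf_series d e f g H n = 0) -> eval_lim H u 0.
Proof.
have [uf ur] := u_path; move=> Hs H0.
apply: (eval_lim_nf0 e_gt0 e_lt_d C_ge1 r_gt0 r_lt1 uf f_monic f_deg _ _ ur Hs H0) => j; exact: bound.
Qed.

(** The relation evaluated as a series has two limits: the relation between the values, by the rules
    for sums and products, and 0, because its normal form vanishes. Limits are unique. *)
Lemma limit_w_relation0 : w_relation d e f' g' id (y 0%N) (y 1%N) = 0.
Proof.
have [uf _] := u_path.
have F_ge i : weight_ge d e (q ^+ i) (orbit_series F i) by exact: orbit_series_ge.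
have ob i : bounded (q ^+ i) (orbit_series F i) by exact: orbit_series_bounded.
have [_ lim1] : evaluates v d e C u (w_relation d e f' g' (@mconst K)
      (orbit_series F 0) (orbit_series F 1))
    (w_relation d e f' g' id (y 0%N) (y 1%N)).
  apply: (evaluates_w_relation e_gt0 e_lt_d C_ge1 r_gt0 r_lt1 uf) => //; try by move=> j; exact: bound.
    by split; [exists (q ^+ 0)|].
  by split; [exists (q ^+ 1)|].
apply: (limit_at_infty_uniq lim1); apply: (@eval0 d%:R).
  apply: coef_bounded_w_relation => //; try by move=> j; exact: bound.
  by rewrite -[q]expr1.
move=> n; have := eq_Slim_nf_eq f_monic f_deg g_deg e_gt0 e_lt_d n (F_morphism 0%N).
rewrite (fseries_subst_path_rel e_gt0 e_lt_d F_ge)// => ->.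
by rewrite nf_series_gt.
Qed.

(** Convergence of [G] at [y] is obtained by comparison with the substituted series at [u], where
    decay is known, instead of from a decay of [y]. *)
Lemma eval_lim_inverse : eval_lim G y (u 0%N).
Proof.
have [uf _] := u_path.
set H := fseries_subst G (orbit_series F).
have Hb : bounded 1 H by exact: bounded_fseries_subst.
have wb : bounded 1 (mvar K 0).
  by rewrite mvarE; apply: coef_bounded_fmono; rewrite weight_var subrr ratpow0 absval1.
have Hw : forall X, v (eval_upto (H - mvar K 0) u X) <= ratpow C (- 1) * ratpow r X.
  have [_ ur] := u_path; move=> X.
  apply: (eval_upto_nf0 e_gt0 e_lt_d C_ge1 r_gt0 r_lt1 uf f_monic f_deg _ _ ur) => //.
  - by move=> j; exact: bound.
  - by move=> j; exact: bound.
  - exact: coef_boundedB.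
  move=> n; rewrite nf_seriesB.
  by rewrite (eq_Slim_nf_eq f_monic f_deg g_deg e_gt0 e_lt_d n (FG 0%N)) subrr.
apply: (limit_at_infty_rate r_gt0 r_lt1 (ratpow_ge0 C (- 1))) => X X1.
have -> : eval_upto G y X - u 0%N = eval_upto (H - mvar K 0) u X - (eval_upto H u X - eval_upto G y X).
  have -> : eval_upto (H - mvar K 0) u X = eval_upto H u X - u 0%N.
    rewrite /eval_upto; under eq_bigr do rewrite fseriesBE mulrBl.
    rewrite sumrB -/(eval_upto (mvar K 0) u X) mvarE eval_upto_fmono ?weight_var//.
    by rewrite mul1r -['X^0]mulr1n monomial_eval_varMn.
  by ring.
apply: absvalB_le; first exact: Hw.
exact: eval_upto_fseries_subst.
Qed.

End Path.

Lemma w_path_image u : w_path f g u ->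
  exists y, [/\ forall i, eval_lim F (fun j => u (i + j)%N) (y i),
    forall i, w_relation d e f' g' id (y i) (y i.+1) = 0,
    v (y 0%N) <= r / C & forall i, eval_lim G (fun j => y (i + j)%N) (u i)].
Proof.
move=> up.
have lims i : exists z, eval_lim F (fun j => u (i + j)%N) z.
  have [uf _] := w_path_shift i up.
  exact: (eval_lim_exists K_complete e_gt0 e_lt_d C_ge1 r_gt0 r_lt1 uf F_bounded).
have [y Fy] := choice lims.
have Fyi i j : eval_lim F (fun l => u (i + (j + l))%N) (y (i + j)%N).
  by have := Fy (i + j)%N; under eq_fun do rewrite -addnA.
exists y; split=> [//|i||i].
- have := limit_w_relation0 (w_path_shift i up) (Fyi i).
  by rewrite addn0 addn1.
- have [uf _] := w_path_shift 0 up.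
  exact: (absval_eval_lim1 e_gt0 e_lt_d C_ge1 r_gt0 r_lt1 uf F_bounded
    (leading_w0_ge e_gt0 e_lt_d F_lead) (Fy 0%N)).
- have := eval_lim_inverse (w_path_shift i up) (Fyi i).
  by rewrite addn0.
Qed.

End Conjugacy.
End Composition.

(** * Paths near infinity *)

Section NearInfinity.
Variables (R : realType) (K : fieldType) (v : nonarch_absval R K).
Implicit Types (p f g : {poly K}) (P Q : sequence_P1 v).

Lemma open_disc_infty (eps : R) : 0 < eps -> open (@disc_infty R K v eps).
Proof.
move=> eps0; split=> [a /= [a0 aeps]|_]; last by exists eps.
(* By the ultrametric inequality the absolute value does not drop below [v a] on the ball of radius
   [v a] around [a]. *)
exists (v a) => [|b bav]; first exact: absval_gt0.
have vab : v a <= v b.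
  rewrite leNgt; apply/negP => vba.
  have : v (b - (b - a)) < v a by exact: absvalB_lt.
  by rewrite subKr ltxx.
have vb : 0 < v b by rewrite (lt_le_trans _ vab)// absval_gt0.
split; first by apply/eqP => b0; move: vb; rewrite b0 absval0 ltxx.
apply: le_lt_trans aeps; rewrite !absvalV lef_pV2 ?posrE//.
exact: absval_gt0.
Qed.

Lemma nbhs_infty_over_disc f g (eps : R) : 0 < eps -> nbhs_infty_in f g (over_disc v f g eps).
Proof.
move=> eps0; split=> [P []//|].
have : nbhs (path_infty v) (@path_proj R K v @^-1` @disc_infty R K v eps).
  apply: (@proj_continuous nat (fun=> P1 v) 0%N (path_infty v)).
  by apply: open_nbhs_nbhs; split; first exact: open_disc_infty.
by apply: filterS => P disc_P path_P; split.
Qed.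

Lemma wcoord_of_wcoord w : wcoord (of_wcoord v w) = w.
Proof. by rewrite /of_wcoord; case: eqP => [->//|_]; rewrite /= invrK. Qed.

Lemma of_wcoord_neq0 w : of_wcoord v w <> Some 0.
Proof. by rewrite /of_wcoord; case: eqVneq => // w0 [/eqP]; rewrite invr_eq0 (negPf w0). Qed.

Lemma wcoordK (x : P1 v) : x <> Some 0 -> of_wcoord v (wcoord x) = x.
Proof.
rewrite /of_wcoord; case: x => [x|_] /=; last by rewrite eqxx.
by rewrite invr_eq0; case: eqVneq => [->//|_ _]; rewrite invrK.
Qed.

Lemma disc_infty_of_wcoord (eps : R) w : v w < eps -> @disc_infty R K v eps (of_wcoord v w).
Proof. by rewrite /of_wcoord; case: eqVneq => //= w0; rewrite invr_neq0 ?invrK. Qed.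

Lemma disc_infty_neq0 (eps : R) (x : P1 v) : disc_infty eps x -> x <> Some 0.
Proof. by case: x => [x [x0 _] [x00]|//]; rewrite x00 eqxx in x0. Qed.

Lemma disc_infty_wcoord (eps : R) (x : P1 v) : 0 < eps -> disc_infty eps x -> v (wcoord x) < eps.
Proof. by move=> eps0; case: x => [x []|_] //=; rewrite absval0. Qed.

Lemma homogZ (A : comNzRingType) n (p : {poly A}) (a : A) (x : A * A) :
  homog n p (a * x.1, a * x.2) = a ^+ n * homog n p x.
Proof.
rewrite /homog big_distrr; apply: eq_bigr => j _ /=.
have -> : a ^+ n = a ^+ j * a ^+ (n - j) by rewrite -exprD subnKC// -ltnS ltn_ord.
by rewrite !exprMn; ring.
Qed.

Lemma correspondenceZ (d e : nat) f g (a b : K) (x y : K * K) :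
  correspondence d e f g (a * x.1, a * x.2) (b * y.1, b * y.2) =
  a ^+ d * b ^+ e * correspondence d e f g x y.
Proof. by rewrite /correspondence !homogZ /= !exprMn; ring. Qed.

Lemma correspondence_w (d e : nat) f g (x y : K) :
  correspondence d e f g (x, 1) (y, 1) = w_relation d e f g id x y.
Proof.
by rewrite /correspondence /w_relation /homog /=; congr (_ * _ - _ * _);
  apply: eq_bigr => j _; rewrite expr1n mulr1.
Qed.

Lemma hcoord_wcoord (x : P1 v) : x <> Some 0 ->
  exists2 a, a != 0 & hcoord x = (a * wcoord x, a * 1).
Proof.
case: x => [x|] /= xn0; last by exists 1; rewrite ?oner_neq0// mulr0 mulr1.
have x0 : x != 0 by apply/eqP => x0; apply: xn0; rewrite x0.
by exists x; rewrite // divff// mulr1.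
Qed.

(** Away from the point 0, the coordinates [hcoord] and those with second entry 1 differ by a
    nonzero factor, and the correspondence is homogeneous in each of the two points. *)
Lemma correspondence_w_eq0 (d e : nat) f g (x y : P1 v) : x <> Some 0 -> y <> Some 0 ->
  correspondence d e f g (hcoord x) (hcoord y) = 0 <->
  w_relation d e f g id (wcoord x) (wcoord y) = 0.
Proof.
move=> /hcoord_wcoord[a a0 ->] /hcoord_wcoord[b b0 ->].
rewrite (correspondenceZ d e f g a b (wcoord x, 1) (wcoord y, 1)) correspondence_w.
split=> [/eqP|->]; last by rewrite mulr0.
by rewrite !mulf_eq0 !expf_eq0 (negPf a0) (negPf b0) !andbF => /eqP.
Qed.

Section Steps.
Variables (d e : nat) (C : R) (f g : {poly K}).
Hypotheses (e_gt0 : (0 < e)%N) (e_lt_d : (e < d)%N) (C_ge1 : 1 <= C).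
Hypotheses (f_monic : f \is monic) (f_deg : size f = d.+1)
  (g_monic : g \is monic) (g_deg : size g = e.+1).
Hypotheses (f_le : coefs_le v C f) (g_le : coefs_le v C g).
Local Notation q := (d%:R / e%:R : rat).

Let C_gt0 : 0 < C. Proof. exact: lt_le_trans ltr01 C_ge1. Qed.

Lemma absval_homog_le p n x : size p = n.+1 -> coefs_le v C p -> v x <= C ->
  v (homog n p (1, x)) <= C ^+ n.
Proof.
move=> pn p_le xC; apply: absval_sum_le => [|j _ _]; first by rewrite exprn_ge0// ltW.
have jn : (j <= n)%N by rewrite -ltnS.
have -> : C ^+ n = C ^+ (n - j) * C ^+ j by rewrite -exprD subnK.
rewrite /= expr1n mulr1 absvalM absvalX.
rewrite ler_pM ?absval_ge0 ?exprn_ge0 ?absval_ge0//.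
  by have := p_le j; rewrite pn; exact.
by rewrite lerXn2r ?nnegrE ?absval_ge0 ?(ltW C_gt0).
Qed.

(** Beyond radius [C] the leading term strictly dominates the sum of all others, so the ultrametric
    inequality becomes an equality. *)
Lemma absval_homog_gt p n x : size p = n.+1 -> p \is monic -> coefs_le v C p -> C < v x ->
  v (homog n p (1, x)) = v x ^+ n.
Proof.
move=> pn p_monic p_le Cx.
have pn1 : p`_n = 1 by move: p_monic; rewrite monicE lead_coefE pn => /eqP.
have x0 : 0 < v x by exact: lt_trans Cx.
rewrite /homog big_ord_recr/= pn1 mul1r expr1n mulr1.
set s := \sum_(j < n) _.
have xn0 : 0 < v x ^+ n by rewrite exprn_gt0.
have sx : v s < v x ^+ n.
  apply: (big_ind (fun y => v y < v x ^+ n)) => [|y z hy hz|j _].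
  - by rewrite absval0.
  - by rewrite (le_lt_trans (absval_ultra _ _ _))// gt_max hy.
  have -> : v x ^+ n = v x ^+ (n - j) * v x ^+ j by rewrite -exprD subnK// ltnW.
  rewrite expr1n mulr1 absvalM absvalX ltr_pM2r ?exprn_gt0//.
  apply: le_lt_trans (_ : C ^+ (n - j) < _).
    by have := p_le j; rewrite pn; apply; rewrite ltnW.
  by rewrite ltrXn2r ?subn_eq0 -?ltnNge// ltW.
apply/eqP; rewrite eq_le -absvalX; apply/andP; split.
  by apply: absvalD_le => //; rewrite absvalX ltW.
rewrite leNgt; apply/negP => h.
have : v (s + x ^+ n - s) < v (x ^+ n) by apply: absvalB_lt => //; rewrite absvalX.
by rewrite addrAC subrr add0r ltxx.
Qed.

Lemma homog_infty p n : size p = n.+1 -> p \is monic -> homog n p (0, 1) = 1.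
Proof.
move=> pn p_monic.
have pn1 : p`_n = 1 by move: p_monic; rewrite monicE lead_coefE pn => /eqP.
rewrite /homog big_ord_recr/= subnn expr0 expr1n pn1 !mulr1 big1 ?add0r// => j _.
by rewrite expr0n subn_eq0 leqNgt ltn_ord mulr0.
Qed.

(** For a finite [x] in the disc, |f(x)| = |x|^d > C^d >= C^e, while |y| <= C would force |g(y)| <=
    C^e. Hence |y| > C, and the leading terms give |y|^e = |x|^d. Infinity is related only to
    itself. *)
Lemma disc_infty_step (x y : P1 v) :
  correspondence d e f g (hcoord x) (hcoord y) = 0 -> disc_infty C^-1 x ->
  disc_infty C^-1 y /\ v (wcoord y) ^+ e = v (wcoord x) ^+ d.
Proof.
have d_gt0 : (0 < d)%N by exact: ltn_trans e_lt_d.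
rewrite /correspondence; case: x => [x|] /=; last first.
  rewrite expr0n gtn_eqF// mul0r sub0r homog_infty// mulr1 => /eqP.
  rewrite oppr_eq0 expf_eq0 e_gt0 => /= /eqP.
  case: y => [y /eqP|_ _]/=; first by rewrite oner_eq0.
  by rewrite absval0 !expr0n !gtn_eqF.
rewrite expr1n mul1r => rel [x0]; rewrite absvalV ltf_pV2 ?posrE ?absval_gt0// => Cx.
case: y rel => [y|] /=; last first.
  by rewrite homog_infty// expr0n gtn_eqF// mul0r subr0 => /eqP; rewrite oner_eq0.
rewrite expr1n mul1r => /eqP; rewrite subr_eq0 => /eqP gf.
have vx := absval_homog_gt f_deg f_monic f_le Cx.
have Cy : C < v y.
  rewrite ltNge; apply/negP => yC.
  have := absval_homog_le g_deg g_le yC; rewrite gf vx leNgt => /negP; apply.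
  apply: (@le_lt_trans _ _ (C ^+ d)); first by rewrite ler_weXn2l// ltnW.
  by rewrite ltrXn2r ?gtn_eqF// ltW.
have y0 : y != 0 by apply/eqP => y0; move: Cy; rewrite y0 absval0 ltNge ltW.
split; first by rewrite absvalV ltf_pV2 ?posrE ?absval_gt0.
by rewrite !absvalV !exprVn -vx -gf (absval_homog_gt g_deg g_monic g_le Cy).
Qed.

Lemma over_disc_w_path P : over_disc v f g C^-1 P ->
  [/\ forall i, P i <> Some 0 & exists r, [/\ 0 < r, r < 1 &
    w_path v d e C r f g (fun i => wcoord (P i))]].
Proof.
have Ci : 0 < C^-1 by rewrite invr_gt0.
move=> [path_P disc_P].
have disc_i i : @disc_infty R K v C^-1 (P i).
  elim: i => [//|i IH]; have := path_P i; rewrite f_deg g_deg => /disc_infty_step/(_ IH)[] //.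
have Pn0 i : P i <> Some 0 by exact: disc_infty_neq0 (disc_i i).
split=> //; set w := fun i => wcoord (P i).
have step i : v (w i.+1) ^+ e = v (w i) ^+ d.
  by have := path_P i; rewrite f_deg g_deg => /disc_infty_step/(_ (disc_i i))[].
have w0 : C * v (w 0%N) < 1.
  by rewrite -ltr_pdivlMl// mulr1; exact: disc_infty_wcoord (disc_i 0%N).
(* The rate must be positive although w_0 = 0 at infinity; any number strictly between 0 and 1 would
   serve in place of 1/2. *)
exists (Num.max (C * v (w 0%N)) 2^-1); split.
- by rewrite lt_max invr_gt0 ltr0n orbT.
- by rewrite gt_max w0 invf_lt1 ?ltr1n.
split=> [i|i]; last first.
  by apply/correspondence_w_eq0 => //; have := path_P i; rewrite f_deg g_deg.
set r := Num.max _ _.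
have r0 : 0 < r by rewrite lt_max invr_gt0 ltr0n orbT.
have rC : 0 < r / C by rewrite divr_gt0.
elim: i => [|i IH].
  rewrite expr0 ratpow1// ler_pdivlMr// mulrC le_max lexx //.
(* After raising to the power e, |w_{i+1}|^e = |w_i|^d matches e (d/e)^(i+1) = d (d/e)^i in the
   exponents. *)
rewrite -(@ler_pXn2r _ e)// ?nnegrE ?absval_ge0 ?ratpow_ge0// step ratpowX ratio_mulXS// -ratpowX.
by rewrite lerXn2r ?nnegrE ?absval_ge0 ?ratpow_ge0.
Qed.

End Steps.
End NearInfinity.

(** * The conjugacy between path spaces *)

Section PathEvaluation.
Variables (R : realType) (K : fieldType) (v : nonarch_absval R K).
Hypothesis K_complete : complete_absval v.
Variables (d e : nat) (C : R).
Hypotheses (e_gt0 : (0 < e)%N) (e_lt_d : (e < d)%N) (C_ge1 : 1 <= C).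
Implicit Types (F G : fseries K) (P Q : sequence_P1 v).

(** A uniform bound by [C >= 1] is at most C^(n-j) for j < n; for j = n the bound asked is 1, and
    the leading coefficient is 1. *)
Lemma coefs_le_monic (p : {poly K}) : p \is monic -> (forall j, v p`_j <= C) -> coefs_le v C p.
Proof.
rewrite monicE lead_coefE => /eqP pn pC j; rewrite leq_eqVlt => /orP[/eqP ->|jn].
  by rewrite pn absval1 subnn expr0.
by rewrite (le_trans (pC j))// ler_eXnr// subn_gt0.
Qed.

Lemma eval_cvg_toP F P y : (forall i, P i <> Some 0) ->
  eval_lim v d e F (fun i => wcoord (P i)) y -> eval_cvg_to d e F P y.
Proof.
move=> Pn0 Fy; split=> // eps /Fy[X0 hX0]; exists X0 => X /hX0.
by rewrite /eval_partial fsbig_finite//; exact: finite_weight.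
Qed.

Lemma eval_seriesE F P y : eval_cvg_to d e F P y -> eval_series d e F P = y.
Proof.
by move=> Fy; apply: xget_subset1 => // a b [_ ha] [_ hb]; exact: limit_at_infty_uniq ha hb.
Qed.

(** Two arbitrary correspondences of the same degrees are allowed, so that the same statement serves
    [xi] in one direction and [gamma] in the other. *)
Lemma orbit_eval_conjugate (f g f' g' : {poly K}) F G P :
  f \is monic -> size f = d.+1 -> g \is monic -> size g = e.+1 ->
  size f' = d.+1 -> size g' = e.+1 ->
  coefs_le v C f -> coefs_le v C g -> coefs_le v C f' -> coefs_le v C g' ->
  leading_w0 F -> coef_bounded v d e C 1 F -> coef_bounded v d e C 1 G ->
  formal_morphism f g f' g' F -> orbits_cancel f g F G ->
  over_disc v f g C^-1 P ->
  [/\ orbit_cvg d e F P, over_disc v f' g' C^-1 (orbit_eval d e F P) &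
      orbit_eval d e G (orbit_eval d e F P) = P].
Proof.
move=> f_monic f_deg g_monic g_deg f'_deg g'_deg f_le g_le f'_le g'_le F1 Fb Gb Fmor FG discP.
have C_gt0 : 0 < C by exact: lt_le_trans C_ge1.
have [Pn0 [r [r0 r1 wP]]] :=
  over_disc_w_path e_gt0 e_lt_d C_ge1 f_monic f_deg g_monic g_deg f_le g_le discP.
have [y [Fy y_rel y0 Gy]] := w_path_image K_complete e_gt0 e_lt_d C_ge1 r0 r1
  f_monic f_deg g_deg f'_deg g'_deg f_le g_le f'_le g'_le F1 Fb Gb Fmor FG wP.
have cvgF i : eval_cvg_to d e F (path_shift i P) (y i).
  by apply: eval_cvg_toP (Fy i) => j; exact: Pn0.
have QE : orbit_eval d e F P = fun i => of_wcoord v (y i).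
  by apply/funext => i; rewrite /orbit_eval (eval_seriesE (cvgF i)).
split.
- by move=> i; exists (y i).
- rewrite QE; split=> [i|].
    rewrite f'_deg g'_deg; apply/correspondence_w_eq0; try exact: of_wcoord_neq0.
    by rewrite !wcoord_of_wcoord.
  apply: disc_infty_of_wcoord; rewrite (le_lt_trans y0)// ltr_pdivrMr// mulVf ?gt_eqF//.
rewrite QE; apply/funext => i; rewrite /orbit_eval.
have -> : eval_series d e G (path_shift i (fun j => of_wcoord v (y j))) = wcoord (P i).
  apply: eval_seriesE; apply: eval_cvg_toP => [j|]; first exact: of_wcoord_neq0.
  by have := Gy i; congr eval_lim; apply/funext => j; rewrite wcoord_of_wcoord.
exact: wcoordK.
Qed.

End PathEvaluation.

Theorem theorem4 (R : realType) (K : fieldType) (v : nonarch_absval R K)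
    (K_sep : separably_closed K) (K_complete : complete_absval v)
    (d e : nat) (f g : {poly K})
    (f_monic : f \is monic) (f_deg : size f = d.+1)
    (g_monic : g \is monic) (g_deg : size g = e.+1)
    (e_gt0 : (0 < e)%N) (e_lt_d : (e < d)%N)
    (ed_unit : integral_unit v (e * d)%:R)
    (xi gamma : fseries K)
    (xi_spec : is_xi f g xi)
    (gamma_spec : formal_inverse f g 'X^d 'X^e xi gamma) :
  (exists U1 U2 : set (sequence_P1 v),
     [/\ nbhs_infty_in f g U1,
         nbhs_infty_in 'X^d 'X^e U2 &
         induces_iso d e xi gamma U1 U2]) /\
  (good_reduction v f g ->
     [/\ nbhs_infty_in f g (over_disc v f g 1),
         nbhs_infty_in 'X^d 'X^e (over_disc v 'X^d 'X^e 1) &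
         induces_iso d e xi gamma
           (over_disc v f g 1) (over_disc v 'X^d 'X^e 1)]).
Proof.
have vd : v d%:R = 1 := absval_unit_factorr ed_unit.
have [gamma_normal xi_mor gamma_mor xi_gamma gamma_xi] := gamma_spec.
have xi1 := xi_leading_w0 e_gt0 e_lt_d f_monic f_deg g_deg xi_spec.
have gamma1 := gamma_leading_w0 e_gt0 e_lt_d f_monic f_deg g_deg xi1 xi_gamma.
have xi_normal m : xi m != 0 -> normal_monomial e m.
  by have [h _] := xi_spec => /h; rewrite g_deg.
have {}gamma_normal m : gamma m != 0 -> normal_monomial e m.
  by move=> /gamma_normal; rewrite size_polyXn.
have [dM eM] : 'X^d \is @monic K /\ 'X^e \is @monic K by rewrite !monicXn.
have [dS eS] : size ('X^d : {poly K}) = d.+1 /\ size ('X^e : {poly K}) = e.+1 by rewrite !size_polyXn.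
(* Both assertions of the theorem are instances of this one, with different constants. *)
have main C : 1 <= C -> (forall j, v f`_j <= C /\ v g`_j <= C) ->
    [/\ nbhs_infty_in f g (over_disc v f g C^-1),
        nbhs_infty_in 'X^d 'X^e (over_disc v 'X^d 'X^e C^-1) &
        induces_iso d e xi gamma (over_disc v f g C^-1) (over_disc v 'X^d 'X^e C^-1)].
  move=> C1 fgC; have C0 : 0 < C by exact: lt_le_trans C1.
  have f_le : coefs_le v C f by apply: coefs_le_monic => // j; have [] := fgC j.
  have g_le : coefs_le v C g by apply: coefs_le_monic => // j; have [] := fgC j.
  have Xn_le n : coefs_le v C 'X^n.
    by apply: coefs_le_monic; rewrite ?monicXn// => j; rewrite coefXn (le_trans (absval_nat_le1 v _)).
  have xib : coef_bounded v d e C 1 xi.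
    exact: (coef_bounded_normal e_gt0 e_lt_d C1 f_monic f_deg g_deg f_le g_le vd eM dS eS).
  have gammab : coef_bounded v d e C 1 gamma.
    exact: (coef_bounded_normal e_gt0 e_lt_d C1 dM dS eS (Xn_le d) (Xn_le e) vd g_monic f_deg g_deg).
  have xi_conj P := orbit_eval_conjugate K_complete e_gt0 e_lt_d C1 f_monic f_deg g_monic g_deg
    dS eS f_le g_le (Xn_le d) (Xn_le e) xi1 xib gammab xi_mor xi_gamma (P := P).
  have gamma_conj Q := orbit_eval_conjugate K_complete e_gt0 e_lt_d C1 dM dS eM eS f_deg g_deg
    (Xn_le d) (Xn_le e) f_le g_le gamma1 gammab xib gamma_mor gamma_xi (P := Q).
  split; try by apply: nbhs_infty_over_disc; rewrite invr_gt0.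
  split.
  - by move=> P /xi_conj[].
  - by move=> Q /gamma_conj[].
  - by split=> [P /xi_conj[]|Q /gamma_conj[]].
  - by move=> P /xi_conj[].
  - by move=> Q /gamma_conj[].
split=> [|gr]; last first.
  by have := main 1 (lexx _); rewrite invr1; apply=> j; exact: gr.
(* The summand 1 secures [1 <= C], and the sums bound every coefficient of [f] and [g]. *)
pose C : R := 1 + \sum_(j < d.+1) v f`_j + \sum_(j < e.+1) v g`_j.
have sum_ge0 n (p : {poly K}) : 0 <= \sum_(j < n) v p`_j.
  by apply: sumr_ge0 => j _; exact: absval_ge0.
have coef_le n (p : {poly K}) j : size p = n -> v p`_j <= \sum_(i < n) v p`_i.
  move=> pn; have [jn|nj] := ltnP j n; last by rewrite nth_default ?pn// absval0.
  rewrite (bigD1 (Ordinal jn))//= lerDl.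
  by apply: sumr_ge0 => i _; exact: absval_ge0.
have [||nf ng iso] := main C.
- by rewrite /C -addrA lerDl addr_ge0.
- move=> j; have := coef_le _ _ j f_deg; have := coef_le _ _ j g_deg.
  have := sum_ge0 d.+1 f; have := sum_ge0 e.+1 g.
  by rewrite /C; set a := \sum_(_ < _) _; set b := \sum_(_ < _) _ => *; split; lra.
by exists (over_disc v f g C^-1), (over_disc v 'X^d 'X^e C^-1).
Qed.
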